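(* The curvature operator $\mathcal{R}$ of the canonical connection of any $3$-$(\alpha,\delta)$-Sasaki manifold $(M,\varphi_i,\xi_i,\eta_i,g)$ of dimension $4n+3$ admits the following six orthogonal eigenforms, where $(ijk)$ denotes an even permutation of $(123)$ and $\beta=2(\delta-2\alpha)$: (1) $\Phi_i-\xi_{jk}=\Phi_i^{\mathcal{H}}-2\xi_{jk}$, $i=1,2,3$, an eigenform with eigenvalue $2\alpha\beta(n+2)$; (2) $\Phi_i+(n+1)\xi_{jk}=\Phi_i^{\mathcal{H}}+n\xi_{jk}$, $i=1,2,3$, an eigenform with eigenvalue $0$.
   Context: An almost contact metric structure $(\varphi,\xi,\eta,g)$ consists of a $(1,1)$-tensor $\varphi$, a vector field $\xi$, a $1$-form $\eta$ and a Riemannian metric $g$ with $\varphi^2=-I+\eta\otimes\xi$, $\eta(\xi)=1$, $\varphi\xi=0$, $\eta\circ\varphi=0$, $g(\varphi X,\varphi Y)=g(X,Y)-\eta(X)\eta(Y)$; its fundamental $2$-form is $\Phi(X,Y)=g(X,\varphi Y)$. An almost $3$-contact metric manifold $(M,\varphi_i,\xi_i,\eta_i,g)$, $i=1,2,3$, is a manifold of dimension $4n+3$ ($n\ge1$) with three almost contact metric structures sharing $g$ such that $\varphi_k=\varphi_i\varphi_j-\eta_j\otimes\xi_i=-\varphi_j\varphi_i+\eta_i\otimes\xi_j$, $\xi_k=\varphi_i\xi_j=-\varphi_j\xi_i$, $\eta_k=\eta_i\circ\varphi_j=-\eta_j\circ\varphi_i$ for every even permutation $(ijk)$ of $(123)$.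 Then $TM=\mathcal{H}\oplus\mathcal{V}$ orthogonally, $\mathcal{V}=\langle\xi_1,\xi_2,\xi_3\rangle$, $\mathcal{H}=\bigcap_i\ker\eta_i$. It is $3$-$(\alpha,\delta)$-Sasaki, for real constants $\alpha\ne0$ and $\delta$, if $d\eta_i=2\alpha\Phi_i+2(\alpha-\delta)\eta_j\wedge\eta_k$ for every even permutation $(ijk)$, with $d\eta(X,Y)=X\eta(Y)-Y\eta(X)-\eta([X,Y])$ and $(\eta\wedge\zeta)(X,Y)=\eta(X)\zeta(Y)-\eta(Y)\zeta(X)$. Put $\beta=2(\delta-2\alpha)$. The canonical connection $\nabla$ is the unique metric connection with totally skew-symmetric torsion $T$ satisfying $\nabla_X\varphi_i=\beta(\eta_k(X)\varphi_j-\eta_j(X)\varphi_k)$ for all $X$ and all even permutations $(ijk)$; it satisfies $\nabla T=0$. Curvature: $R(X,Y,Z,V)=g([\nabla_X,\nabla_Y]Z-\nabla_{[X,Y]}Z,V)$, which is pair symmetric, and $\mathcal{R}\colon\Lambda^2TM\to\Lambda^2TM$ is the symmetric operator $\langle\mathcal{R}(X\wedge Y),Z\wedge V\rangle=-R(X,Y,Z,V)$, where $\langle u_1\wedge u_2,v_1\wedge v_2\rangle=\det[g(u_i,v_j)]$. $2$-forms and $2$-vectors are identified via this inner product, so $\langle\omega,X\wedge Y\rangle=\omega(X,Y)$. Notation: $\xi_{jk}=\xi_j\wedge\xi_k=\eta_j\wedge\eta_k$, and $\Phi_i^{\mathcal{H}}=\Phi_i+\xi_{jk}\in\Lambda^2\mathcal{H}$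 is the horizontal part of $\Phi_i$. *)

(* Defs.v *)
From HB Require Import structures.
From mathcomp Require Import all_boot all_order all_algebra all_fingroup ring.
From mathcomp Require Import all_classical all_reals all_analysis.
Import Order.TTheory GRing.Theory Num.Theory.
Import numFieldNormedType.Exports.
Set Implicit Arguments.
Unset Strict Implicit.
Unset Printing Implicit Defensive.
Local Open Scope classical_set_scope.
Local Open Scope ring_scope.

(* A smooth manifold is a Hausdorff,
   second countable space with a smooth atlas; a tensor field (or a linear
   connection) is, classically, a family of component functions, one for each
   chart and defined on the image of that chart, that obeys the transformation
   law on overlaps.
   Tangent vectors are row vectors of components and an endomorphism acts on the
   right, so that the matrix of a composition f \o h is (matrix of h) *m (matrix
   of f); compositions are therefore always written through [app]. *)

Fixpoint Ck (R : realType) (m : nat) (W : normedModType R) (k : nat)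
    (U : set 'rV[R]_m) (f : 'rV[R]_m -> W) : Prop :=
  if k is k'.+1 then
    [/\ forall x, U x -> {for x, continuous f},
        forall x v, U x -> derivable f x v
      & forall v, Ck k' U (fun x => 'D_v f x)]
  else forall x, U x -> {for x, continuous f}.

(* Used for open U only. *)
Definition smooth (R : realType) (m : nat) (W : normedModType R)
    (U : set 'rV[R]_m) (f : 'rV[R]_m -> W) : Prop :=
  forall k, Ck k U f.

(* [cmap] and [cinv] are total functions; their values outside [cdom], resp.
   [cimg], are irrelevant. *)
Record chart (R : realType) (m : nat) (M : topologicalType) := Chart {
  cdom : set M;
  cimg : set 'rV[R]_m;
  cmap : M -> 'rV[R]_m;
  cinv : 'rV[R]_m -> M;
  cdom_open : open cdom;
  cimg_open : open cimg;
  cmap_img : forall p, cdom p -> cimg (cmap p);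
  cinv_dom : forall x, cimg x -> cdom (cinv x);
  cmapK : forall p, cdom p -> cinv (cmap p) = p;
  cinvK : forall x, cimg x -> cmap (cinv x) = x;
  cmap_continuous : {within cdom, continuous cmap};
  cinv_continuous : {within cimg, continuous cinv} }.

Definition overlap (R : realType) (m : nat) (M : topologicalType)
    (c c' : chart R m M) : set 'rV[R]_m :=
  [set x | cimg c x /\ cdom c' (cinv c x)].

Definition transition (R : realType) (m : nat) (M : topologicalType)
    (c c' : chart R m M) (x : 'rV[R]_m) : 'rV[R]_m :=
  cmap c' (cinv c x).

Record manifold (R : realType) (m : nat) := Manifold {
  points :> topologicalType;
  points_hausdorff : hausdorff_space points;
  points_second_countable : @second_countable points;
  charts : Type;
  chart_of : charts -> chart R m points;
  atlas_cover : forall p, exists c, cdom (chart_of c) p;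
  atlas_smooth : forall c c',
    smooth (overlap (chart_of c) (chart_of c'))
           (transition (chart_of c) (chart_of c')) }.

Section LinearAlgebra.
Context {R : realType} {m : nat}.
Implicit Types (u v : 'rV[R]_m) (A B W g : 'M[R]_m) (e z : 'cV[R]_m).

Definition app (f : 'M[R]_m) u : 'rV[R]_m := u *m f.
Definition ev1 e u : R := (u *m e) 0 0.
Definition ev2 W u v : R := (u *m W *m v^T) 0 0.

Definition skew A : Prop := A^T = - A.

(* Elements of the second exterior power of the tangent space are skew matrices
   A = \sum_(a < b) A a b (e_a /\ e_b), and 2-forms are the skew matrices
   W a b = W(e_a, e_b). *)
Definition wedgev u v : 'M[R]_m := u^T *m v - v^T *m u.
Definition wedgef e z : 'M[R]_m := e *m z^T - z *m e^T.

Definition inner2 g A B : R := 2^-1 * \tr (A^T *m g *m B *m g).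

(* The 2-vector identified with the 2-form W: see [inner2_sharp]. *)
Definition sharp g W : 'M[R]_m := invmx g *m W *m invmx g.

Definition inner2f g W W' : R := inner2 g (sharp g W) (sharp g W').

Definition posdef_sym g : Prop :=
  g^T = g /\ forall u, u != 0 -> 0 < ev2 g u u.

Definition eigenform g (L : 'M[R]_m -> 'M[R]_m) (lam : R) W : Prop :=
  [/\ skew W, W != 0 & L (sharp g W) = lam *: sharp g W].

Lemma ev2_wedgef e z u v :
  ev2 (wedgef e z) u v = ev1 e u * ev1 z v - ev1 z u * ev1 e v.
Proof.
have tr1 (d : 'cV[R]_m) : d^T *m v^T = (ev1 d v)%:M.
  by rewrite -trmx_mul [v *m d]mx11_scalar tr_scalar_mx.
rewrite /ev2 /wedgef mulmxBr mulmxBl !mulmxA -!(mulmxA (u *m _)) !tr1.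
by rewrite !mul_mx_scalar !mxE /ev1 !mxE mulrC [X in _ - X]mulrC.
Qed.

Lemma inner2_wedger g A u v : g^T = g -> skew A ->
  inner2 g A (wedgev u v) = ev2 (g *m A *m g) u v.
Proof.
move=> gs As; rewrite /inner2 /wedgev As.
have E a b : \tr (- A *m g *m (a^T *m b) *m g) = - ev2 (g *m A *m g) b a.
  rewrite mulmxA -(mulmxA (_ *m a^T)) mxtrace_mulC /mxtrace big_ord1.
  by rewrite /ev2 !mulNmx mulmxN !mulmxA mxE.
rewrite mulmxBr mulmxBl raddfB /= !E opprK.
have -> : ev2 (g *m A *m g) v u = - ev2 (g *m A *m g) u v.
  rewrite /ev2 -[v *m _ *m _]trmxK mxE !trmx_mul trmxK gs As.
  by rewrite !(mulmxN, mulNmx) !mulmxA mxE.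
by field.
Qed.

Lemma posdef_unit g : posdef_sym g -> g \in unitmx.
Proof.
move=> [_ gp]; rewrite -row_free_unit -kermx_eq0; apply/rowV0P => u /sub_kermxP ug.
apply/eqP; apply: contraTT isT => u0; have := gp u u0.
by rewrite /ev2 ug mul0mx mxE ltxx.
Qed.

Lemma skew_wedgev u v : skew (wedgev u v).
Proof. by rewrite /skew /wedgev linearB /= !trmx_mul !trmxK opprB. Qed.

Lemma inner2_wedge g u1 u2 v1 v2 : g^T = g ->
  inner2 g (wedgev u1 u2) (wedgev v1 v2) =
  ev2 g u1 v1 * ev2 g u2 v2 - ev2 g u1 v2 * ev2 g u2 v1.
Proof.
move=> gs; rewrite inner2_wedger //; last exact: skew_wedgev.
have S a b : ev2 g a b = ev2 g b a.
  by rewrite /ev2 -[b *m g *m _]trmxK [RHS]mxE !trmx_mul trmxK gs mulmxA.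
have E a b : (v1 *m (g *m (a^T *m b) *m g) *m v2^T) 0 0 = ev2 g v1 a * ev2 g b v2.
  rewrite /ev2 !mulmxA -!(mulmxA (v1 *m g *m a^T)) !mulmxA.
  rewrite -(mulmxA _ b) -(mulmxA _ (b *m g)) [v1 *m g *m a^T]mx11_scalar.
  by rewrite mul_scalar_mx !mxE mulr1n.
have B (P Q : 'M[R]_1) : (P - Q) 0 0 = P 0 0 - Q 0 0 by rewrite !mxE.
rewrite {1}/ev2 /wedgev !(mulmxBr, mulmxBl) !B.
by rewrite !E !(S v1); ring.
Qed.

Lemma inner2_sharp g W u v : posdef_sym g -> skew W ->
  inner2 g (sharp g W) (wedgev u v) = ev2 W u v.
Proof.
move=> gp Ws; have [gs _] := gp; have gu := posdef_unit gp.
rewrite inner2_wedger //; last first.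
  by rewrite /skew /sharp !trmx_mul trmx_inv gs Ws mulNmx mulmxN mulmxA.
by rewrite /sharp !mulmxA mulmxV // mul1mx mulmxKV.
Qed.

End LinearAlgebra.

(* [even3 i j k]: (i j k) is an even permutation of the three indices. *)
Definition even3 (i j k : 'I_3) : Prop :=
  exists s : 'S_3, [/\ ~~ odd_perm s, i = s 0, j = s 1 & k = s 2].

Section LocalCalculus.
Context {R : realType} {m : nat}.
Implicit Types X Y Z V : 'rV[R]_m -> 'rV[R]_m.

(* The coordinate derivative X^a d_a f of f along the vector field X. *)
Definition along (W : normedModType R) X (f : 'rV[R]_m -> W) (x : 'rV[R]_m) : W :=
  \sum_a X x 0 a *: 'D_(delta_mx 0 a) f x.

Definition bracket X Y (x : 'rV[R]_m) : 'rV[R]_m := along X Y x - along Y X x.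

Definition d1 (e : 'rV[R]_m -> 'cV[R]_m) X Y (x : 'rV[R]_m) : R :=
  along (W := R) X (fun y => ev1 (e y) (Y y)) x
  - along (W := R) Y (fun y => ev1 (e y) (X y)) x
  - ev1 (e x) (bracket X Y x).

(* Christoffel symbols: [G a] is the matrix of v |-> nabla_(d_a) v. *)
Definition christoffel (G : 'I_m -> 'M[R]_m) (u v : 'rV[R]_m) : 'rV[R]_m :=
  \sum_a u 0 a *: (v *m G a).

Definition nabla (G : 'rV[R]_m -> 'I_m -> 'M[R]_m) X Y (x : 'rV[R]_m) : 'rV[R]_m :=
  along X Y x + christoffel (G x) (X x) (Y x).

Definition nabla_end G X (f : 'rV[R]_m -> 'M[R]_m) Y (x : 'rV[R]_m) : 'rV[R]_m :=
  nabla G X (fun y => app (f y) (Y y)) x - app (f x) (nabla G X Y x).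

Definition torsion G X Y (x : 'rV[R]_m) : 'rV[R]_m :=
  nabla G X Y x - nabla G Y X x - bracket X Y x.

Definition curvature G X Y Z (x : 'rV[R]_m) : 'rV[R]_m :=
  nabla G X (nabla G Y Z) x - nabla G Y (nabla G X Z) x
  - nabla G (bracket X Y) Z x.

End LocalCalculus.

Section Geometry.
Context {R : realType} {m : nat}.
Variable M : manifold R m.

Definition field (T : Type) := charts M -> 'rV[R]_m -> T.

Definition img (c : charts M) : set 'rV[R]_m := cimg (chart_of c).
Definition ovl (c c' : charts M) : set 'rV[R]_m := overlap (chart_of c) (chart_of c').
Definition tau (c c' : charts M) : 'rV[R]_m -> 'rV[R]_m :=
  transition (chart_of c) (chart_of c').
Definition dtau (c c' : charts M) (x v : 'rV[R]_m) : 'rV[R]_m := 'D_v (tau c c') x.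

Definition vector_field (X : field 'rV[R]_m) : Prop :=
  (forall c, smooth (img c) (X c)) /\
  forall c c' x, ovl c c' x -> X c' (tau c c' x) = dtau c c' x (X c x).

Definition one_form (e : field 'cV[R]_m) : Prop :=
  (forall c, smooth (img c) (e c)) /\
  forall c c' x u, ovl c c' x ->
    ev1 (e c x) u = ev1 (e c' (tau c c' x)) (dtau c c' x u).

Definition endomorphism_field (f : field 'M[R]_m) : Prop :=
  (forall c, smooth (img c) (f c)) /\
  forall c c' x u, ovl c c' x ->
    dtau c c' x (app (f c x) u) = app (f c' (tau c c' x)) (dtau c c' x u).

Definition riemannian_metric (g : field 'M[R]_m) : Prop :=
  [/\ forall c, smooth (img c) (g c),
      forall c c' x u v, ovl c c' x ->
        ev2 (g c x) u v = ev2 (g c' (tau c c' x)) (dtau c c' x u) (dtau c c' x v)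
    & forall c x, img c x -> posdef_sym (g c x)].

Definition connection (G : field ('I_m -> 'M[R]_m)) : Prop :=
  (forall c a, smooth (img c) (fun x => G c x a)) /\
  forall c c' x u v, ovl c c' x ->
    dtau c c' x (christoffel (G c x) u v) =
    'D_u (fun y => dtau c c' y v) x
    + christoffel (G c' (tau c c' x)) (dtau c c' x u) (dtau c c' x v).

Record almost_contact_metric (f : field 'M[R]_m) (xi : field 'rV[R]_m)
    (eta : field 'cV[R]_m) (g : field 'M[R]_m) : Prop := {
  acm_phi : endomorphism_field f;
  acm_xi : vector_field xi;
  acm_eta : one_form eta;
  acm_g : riemannian_metric g;
  acm_sqr : forall c x u, img c x ->
    app (f c x) (app (f c x) u) = - u + ev1 (eta c x) u *: xi c x;
  acm_eta_xi : forall c x, img c x -> ev1 (eta c x) (xi c x) = 1;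
  acm_phi_xi : forall c x, img c x -> app (f c x) (xi c x) = 0;
  acm_eta_phi : forall c x u, img c x -> ev1 (eta c x) (app (f c x) u) = 0;
  acm_compat : forall c x u v, img c x ->
    ev2 (g c x) (app (f c x) u) (app (f c x) v) =
    ev2 (g c x) u v - ev1 (eta c x) u * ev1 (eta c x) v }.

Record almost_3_contact_metric (phi : 'I_3 -> field 'M[R]_m)
    (xi : 'I_3 -> field 'rV[R]_m) (eta : 'I_3 -> field 'cV[R]_m)
    (g : field 'M[R]_m) : Prop := {
  a3c_acm : forall i, almost_contact_metric (phi i) (xi i) (eta i) g;
  a3c_phi : forall i j k c x u, even3 i j k -> img c x ->
    app (phi k c x) u =
      app (phi i c x) (app (phi j c x) u) - ev1 (eta j c x) u *: xi i c x /\
    app (phi k c x) u =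
      - app (phi j c x) (app (phi i c x) u) + ev1 (eta i c x) u *: xi j c x;
  a3c_xi : forall i j k c x, even3 i j k -> img c x ->
    xi k c x = app (phi i c x) (xi j c x) /\
    xi k c x = - app (phi j c x) (xi i c x);
  a3c_eta : forall i j k c x u, even3 i j k -> img c x ->
    ev1 (eta k c x) u = ev1 (eta i c x) (app (phi j c x) u) /\
    ev1 (eta k c x) u = - ev1 (eta j c x) (app (phi i c x) u) }.

(* Phi(X, Y) = g(X, phi Y): transposed because [app] acts on the right. *)
Definition Phi (f g : field 'M[R]_m) : field 'M[R]_m :=
  fun c x => g c x *m (f c x)^T.

(* The orthogonal projection X |-> X - \sum_l eta_l(X) xi_l onto H. *)
Definition hproj (xi : 'I_3 -> field 'rV[R]_m) (eta : 'I_3 -> field 'cV[R]_m) :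
    field 'M[R]_m :=
  fun c x => 1%:M - \sum_l eta l c x *m xi l c x.

(* (X, Y) |-> W(X_H, Y_H) *)
Definition horizontal_part xi eta (W : field 'M[R]_m) : field 'M[R]_m :=
  fun c x => hproj xi eta c x *m W c x *m (hproj xi eta c x)^T.

Definition three_alpha_delta_Sasaki (alpha delta : R) phi xi eta g : Prop :=
  [/\ almost_3_contact_metric phi xi eta g, alpha != 0
    & forall i j k c X Y x, even3 i j k ->
        smooth (img c) X -> smooth (img c) Y -> img c x ->
        d1 (eta i c) X Y x =
        2 * alpha * ev2 (Phi (phi i) g c x) (X x) (Y x)
        + 2 * (alpha - delta) *
            ev2 (wedgef (eta j c x) (eta k c x)) (X x) (Y x)].

Definition metric_connection (g : field 'M[R]_m) G : Prop :=
  forall c X Y Z x, smooth (img c) X -> smooth (img c) Y -> smooth (img c) Z ->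
    img c x ->
    along (W := R) X (fun y => ev2 (g c y) (Y y) (Z y)) x =
    ev2 (g c x) (nabla (G c) X Y x) (Z x) + ev2 (g c x) (Y x) (nabla (G c) X Z x).

(* Skewness in the first two arguments is automatic. *)
Definition skew_torsion (g : field 'M[R]_m) G : Prop :=
  forall c X Y Z x, smooth (img c) X -> smooth (img c) Y -> smooth (img c) Z ->
    img c x ->
    ev2 (g c x) (torsion (G c) X Y x) (Z x) =
    - ev2 (g c x) (torsion (G c) X Z x) (Y x).

Definition canonical_connection (alpha delta : R) (phi : 'I_3 -> field 'M[R]_m)
    (eta : 'I_3 -> field 'cV[R]_m) (g : field 'M[R]_m)
    (G : field ('I_m -> 'M[R]_m)) : Prop :=
  let beta := 2 * (delta - 2 * alpha) in
  [/\ connection G, metric_connection g G, skew_torsion g G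
    & forall i j k c X Y x, even3 i j k ->
        smooth (img c) X -> smooth (img c) Y -> img c x ->
        nabla_end (G c) X (phi i c) Y x =
        beta *: (ev1 (eta k c x) (X x) *: app (phi j c x) (Y x)
                 - ev1 (eta j c x) (X x) *: app (phi k c x) (Y x))].

(* L is the curvature operator at the point with coordinates x in the chart c.
   Only the restriction of L to skew matrices matters, and these conditions
   determine it: see [curvature_operator_uniq]. *)
Definition curvature_operator (g : field 'M[R]_m) G (c : charts M)
    (x : 'rV[R]_m) (L : {linear 'M[R]_m -> 'M[R]_m}) : Prop :=
  [/\ forall A, skew A -> skew (L A),
      forall A B, skew A -> skew B -> inner2 (g c x) (L A) B = inner2 (g c x) A (L B)
    & forall X Y Z V, smooth (img c) X -> smooth (img c) Y ->
        smooth (img c) Z -> smooth (img c) V ->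
        inner2 (g c x) (L (wedgev (X x) (Y x))) (wedgev (Z x) (V x)) =
        - ev2 (g c x) (curvature (G c) X Y Z x) (V x)].

Lemma smooth_cst (W : normedModType R) (U : set 'rV[R]_m) (w : W) :
  smooth U (fun=> w).
Proof.
move=> k; elim: k w => [|k IH] w /=; first by move=> x _; exact: cst_continuous.
split=> [x _|x v _|v]; [exact: cst_continuous|exact: derivable_cst|].
have -> : (fun x => 'D_v (fun=> w) x) = fun=> (0 : W).
  by apply/funext => x; rewrite derive_cst.
exact: IH.
Qed.

Lemma curvature_operator_uniq g G c x L L' : riemannian_metric g -> img c x ->
  curvature_operator g G c x L -> curvature_operator g G c x L' ->
  forall A, skew A -> L A = L' A.
Proof.
move=> [_ _ /(_ c x)] gp /gp {gp} gp [Ls _ LR] [Ls' _ LR'].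
have [gs _] := gp; have gu := posdef_unit gp.
have E u v : L (wedgev u v) = L' (wedgev u v).
  apply/eqP; rewrite -subr_eq0; set D := _ - _.
  have Ds : skew D.
    by rewrite /skew linearB /= Ls ?Ls' ?opprB ?opprK; try exact: skew_wedgev;
       rewrite addrC.
  have D0 z w : ev2 (g c x *m D *m g c x) z w = 0.
    have := LR (fun=> u) (fun=> v) (fun=> z) (fun=> w).
    rewrite -(LR' (fun=> u) (fun=> v) (fun=> z) (fun=> w)); try exact: smooth_cst.
    move=> /(_ (smooth_cst _ _) (smooth_cst _ _) (smooth_cst _ _) (smooth_cst _ _)).
    rewrite !inner2_wedger //; try by [apply: Ls; apply: skew_wedgev
                                      |apply: Ls'; apply: skew_wedgev].
    move=> H; rewrite /ev2 /D mulmxBr mulmxBl mulmxBr mulmxBl mxE [X in _ + X]mxE.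
    by apply/eqP; rewrite subr_eq0; apply/eqP.
  have gDg : g c x *m D *m g c x = 0.
    apply/matrixP => a b; rewrite [RHS]mxE -(D0 (delta_mx 0 a) (delta_mx 0 b)).
    by rewrite /ev2 trmx_delta -rowE -colE !mxE.
  by rewrite -[D](mulKmx gu) -[_ *m D](mulmxK gu) gDg mul0mx mulmx0.
move=> A As.
have -> : A = \sum_a \sum_b (2^-1 * A a b) *: wedgev (delta_mx 0 a) (delta_mx 0 b).
  have AE : A = 2^-1 *: (A - A^T).
    by rewrite As opprK -mulr2n -[A *+ 2]scaler_nat scalerA mulVf ?scale1r ?pnatr_eq0.
  rewrite {1}AE {1 2}[A]matrix_sum_delta linear_sum -sumrB scaler_sumr.
  apply: eq_bigr => a _; rewrite linear_sum -sumrB scaler_sumr.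
  apply: eq_bigr => b _; rewrite linearZ /= -scalerBr scalerA /wedgev.
  by rewrite !trmx_delta !mul_delta_mx.
rewrite !linear_sum; apply: eq_bigr => a _; rewrite !linear_sum.
by apply: eq_bigr => b _; rewrite !linearZ /= E.
Qed.

End Geometry.

(* Main.v *)
From HB Require Import structures.
Require Import Defs.
From mathcomp Require Import all_boot all_order all_algebra all_fingroup.
From mathcomp Require Import all_classical all_reals all_analysis.
From mathcomp Require Import ring lra.
Import Order.TTheory GRing.Theory Num.Theory.
Import numFieldNormedType.Exports.
Set Implicit Arguments.
Unset Strict Implicit.
Unset Printing Implicit Defensive.
Local Open Scope classical_set_scope.
Local Open Scope ring_scope.

(** Write W_i for Phi_i - eta_j /\ eta_k.  The connection rotates the phi_i among
    themselves by the 1-forms beta eta_k, so the commutator of two covariant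
    derivatives rotates them by 2-forms, and these turn out to be multiples of
    the W_i (lemma [curv_mx_phi]):
      R(X,Y) phi_i - phi_i R(X,Y) =
        2 alpha beta (W_k(X,Y) phi_j - W_j(X,Y) phi_k),
    products being compositions.  Applied to xi_j this gives
    g(R(X,Y) xi_j, xi_k) = 2 alpha beta W_i(X,Y); multiplied by a phi and traced
    it gives the trace of R(X,Y) phi_i as another multiple of W_i(X,Y)
    (lemmas [xi_curv_eta] and [tr_curv_phi]).  Pair symmetry of R identifies
    these two numbers, up to constants, with the components of the images under
    the curvature operator of eta_j /\ eta_k and of Phi_i.  Hence the operator maps
    Phi_i + a eta_j /\ eta_k to 2 alpha beta (n + 1 - a) W_i ([curv_op_eigen]): the
    value a = -1 gives the eigenvalue 2 alpha beta (n + 2), and a = n + 1 the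
    kernel.  Orthogonality is a computation with traces of products of the
    phi_i ([inner2f_pencil] and [inner2f_pencil_rot]).

    The substance is thus pair symmetry.  For a metric connection with skew
    torsion T it follows from the first Bianchi identity as soon as T is
    parallel: the cyclic sum of g(R(X,Y)Z,V) is then the cyclic sum of
    g(T(X,Y),T(Z,V)), which is a 4-form ([first_Bianchi], [curv_mx_pair]).  To see
    that T is parallel one determines it:
      T = 2 alpha sum_i eta_i /\ Phi_i + 2 (delta - alpha) eta_1 /\ eta_2 /\ eta_3
    ([tors3E]).  Its components along the xi_i come from the formula for d eta_i
    and the covariant derivative of eta_i.  Its horizontal part vanishes: by
    d (d eta_i) = 0 the cyclic sum of Phi_i(T(X,Y),Z) is zero on horizontal vectors,
    so that phi_i acts by zero, as a derivation, on the horizontal part of T; but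
    a complex structure acts on 3-forms as a derivation with the eigenvalues
    i, -i, 3i and -3i only, hence injectively ([tors3_phi_horizontal],
    [tors3_horizontal]).  The right-hand side above is invariant under simultaneous
    rotations of the eta_i and the Phi_i, hence parallel ([parallel_torsion]).

    Everything takes place in one chart, with constant coordinate fields;
    [canonical_localP] translates the hypotheses and [curvatureE] returns to
    arbitrary fields.  The only analytic input beyond the product rule is the
    symmetry of second derivatives. *)

(** * Symmetry of second derivatives *)

Section Schwarz.
Context {R : realType} {V : normedModType R}.
Implicit Types (f : V -> R) (x y v w : V) (U : set V).

Lemma is_derive_line f y v (s : R) : derivable f (s *: v + y) v ->
  is_derive s (1 : R) (fun r : R => f (r *: v + y)) ('D_v f (s *: v + y)).
Proof.
move=> df.
have E : (fun h : R => h^-1 *: (((fun r : R => f (r *: v + y)) \o shift s) (h *: (1 : R))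
     - f (s *: v + y))) =
   (fun h => h^-1 *: ((f \o shift (s *: v + y)) (h *: v) - f (s *: v + y))).
  apply/funext => h /=; congr (_ *: (f _ - _)).
  by rewrite [_ *: 1]mulr1 scalerDl addrA.
by apply: DeriveDef; [rewrite /derivable E|rewrite /derive E].
Qed.

(** The second difference is symmetric in v and w, while two applications of the
    mean value theorem, first along v and then along w, turn it into a value of
    the iterated derivative close to x. *)
Lemma second_difference f U x v w (h : R) : 0 < h ->
  (forall s t : R, 0 <= s <= h -> 0 <= t <= h -> U (t *: w + (s *: v + x))) ->
  (forall y, U y -> derivable f y v) ->
  (forall y, U y -> derivable ('D_v f) y w) ->
  exists s t : R, [/\ 0 <= s <= h, 0 <= t <= h &
    f (h *: w + (h *: v + x)) - f (h *: v + x) - f (h *: w + x) + f x =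
    'D_w ('D_v f) (t *: w + (s *: v + x)) * h * h].
Proof.
move=> h0 Usub dv dwv.
have Uw0 s : 0 <= s <= h -> U (s *: v + x).
  move=> sh; have := Usub s 0 sh; rewrite scale0r add0r; apply.
  by rewrite lexx ltW.
have Uwh s : 0 <= s <= h -> U (s *: v + (h *: w + x)).
  by move=> sh; have := Usub s h sh; rewrite addrCA; apply; rewrite lexx ltW.
have sub_itv (s : R) : s \in `]0, h[%R -> 0 <= s <= h.
  by rewrite in_itv /= => /andP[a b]; rewrite !ltW.
pose a (s : R) := f (s *: v + (h *: w + x)) - f (s *: v + x).
have da s : 0 <= s <= h -> is_derive s (1 : R) a
    ('D_v f (s *: v + (h *: w + x)) - 'D_v f (s *: v + x)).
  by move=> sh; apply: is_deriveB; apply: is_derive_line; apply: dv; auto.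
have [|s /sub_itv sh sE] := MVT h0 (fun s sh => da s (sub_itv s sh)).
  apply: derivable_within_continuous => s; rewrite in_itv /= => sh.
  by have [] := da s sh.
pose b (t : R) := 'D_v f (t *: w + (s *: v + x)).
have db t : 0 <= t <= h -> is_derive t (1 : R) b
    ('D_w ('D_v f) (t *: w + (s *: v + x))).
  by move=> th; apply: is_derive_line; apply: dwv; auto.
have [|t /sub_itv th tE] := MVT h0 (fun t th => db t (sub_itv t th)).
  apply: derivable_within_continuous => t; rewrite in_itv /= => th.
  by have [] := db t th.
exists s, t; split => //.
move: sE tE; rewrite /a /b !scale0r !add0r !subr0 => sE tE.
rewrite -tE -[s *: v + (h *: w + x)]addrCA in sE *.
by rewrite -sE [h *: v + (_ + x)]addrCA; ring.
Qed.

(** The values of the two iterated derivatives given by [second_difference] agree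
    and are taken at points arbitrarily close to x. *)
Lemma derive_comm f U x v w : open U -> U x ->
  (forall y, U y -> derivable f y v) ->
  (forall y, U y -> derivable f y w) ->
  (forall y, U y -> derivable ('D_v f) y w) ->
  (forall y, U y -> derivable ('D_w f) y v) ->
  {for x, continuous ('D_w ('D_v f))} -> {for x, continuous ('D_v ('D_w f))} ->
  'D_w ('D_v f) x = 'D_v ('D_w f) x.
Proof.
move=> Uo Ux dv dw dwv dvw cwv cvw.
apply/eqP; rewrite -subr_eq0 -normr_le0; apply/ler_addgt0Pr => e e0; rewrite add0r.
have e2 : 0 < e / 2 by rewrite divr_gt0.
have N : \forall y \near x, [/\ U y, `|'D_w ('D_v f) x - 'D_w ('D_v f) y| < e / 2 &
    `|'D_v ('D_w f) x - 'D_v ('D_w f) y| < e / 2].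
  have N0 := open_nbhs_nbhs (conj Uo Ux).
  have N1 := (cvgrPdist_lt _ _).1 cwv _ e2.
  have N2 := (cvgrPdist_lt _ _).1 cvw _ e2.
  move: N0 N1 N2 => N0 /(_ _) N1 /(_ _) N2; apply: filterS3 N0 N1 N2 => y; exact: And3.
have [r /= r0 rN] := (nbhs_ballP _ _).1 N.
pose K := `|v| + `|w| + 1.
have K0 : 0 < K by rewrite ltr_wpDl ?addr_ge0.
(* the + 1 in K keeps h finite when v = w = 0 *)
pose h := r / (2 * K).
have h0 : 0 < h by rewrite divr_gt0 ?mulr_gt0.
have near_x (s t : R) (a b : V) : `|a| + `|b| + 1 = K ->
    0 <= s <= h -> 0 <= t <= h -> ball x r (t *: b + (s *: a + x)).
  move=> abK /andP[s0 sh] /andP[t0 th].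
  rewrite -ball_normE /ball_ /= addrA opprD addrCA subrr addr0 normrN.
  apply: le_lt_trans (ler_normD _ _) _; rewrite !normrZ !ger0_norm //.
  apply: (@le_lt_trans _ _ (h * (K - 1))).
    rewrite -abK addrK mulrDr addrC; apply: lerD; exact: ler_wpM2r.
  apply: (@lt_trans _ _ (h * K)); first by rewrite ltr_pM2l // ltrBlDr ltrDl.
  by rewrite /h invfM -!mulrA mulVf ?gt_eqF // mulr1 gtr_pMr // invf_lt1 ?ltr1n.
have Usub (a b : V) : `|a| + `|b| + 1 = K ->
    forall s t : R, 0 <= s <= h -> 0 <= t <= h -> U (t *: b + (s *: a + x)).
  by move=> abK s t sh th; have [] := rN _ (near_x s t a b abK sh th).
have wvK : `|w| + `|v| + 1 = K by rewrite [`|w| + _]addrC.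
have [s [t [sh th E1]]] := second_difference h0 (Usub v w erefl) dv dwv.
have [s' [t' [sh' th' E2]]] := second_difference h0 (Usub w v wvK) dw dvw.
have E : 'D_w ('D_v f) (t *: w + (s *: v + x)) = 'D_v ('D_w f) (t' *: v + (s' *: w + x)).
  have h_neq0 : h != 0 by rewrite gt_eqF.
  apply: (mulIf h_neq0); apply: (mulIf h_neq0).
  apply: etrans (esym E1) _; apply: etrans _ E2.
  by rewrite [h *: v + (_ + x)]addrCA; ring.
have [_ A _] := rN _ (near_x s t v w erefl sh th).
have [_ _ B] := rN _ (near_x s' t' w v wvK sh' th').
rewrite E in A; rewrite (splitr e).
move: ('D_v ('D_w f) (t' *: v + _)) A B => P.
move: ('D_w ('D_v f) x) ('D_v ('D_w f) x) => a b A B.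
rewrite -(subrKA P); apply: le_trans (ler_normD _ _) _.
by apply: lerD; [exact: ltW A|rewrite distrC; exact: ltW B].
Qed.

End Schwarz.

(** * Derivatives along constant vector fields *)
Section DirectionalDerivatives.
Context {R : realType} {m : nat}.
Implicit Types (u v x : 'rV[R]_m) (U : set 'rV[R]_m).

(** Derivatives along a vector are sums of partial derivatives, as in [along]; the
    existence of the partial derivatives at x is part of the predicate, so that it
    is stable under sums and products. *)
Definition has_dir {W : normedModType R} u (f : 'rV[R]_m -> W) x (d : W) : Prop :=
  exists2 df : 'I_m -> W,
    forall a, is_derive x (delta_mx 0 a) f (df a) & d = \sum_a u 0 a *: df a.

Lemma is_derive_mxP p q (f : 'rV[R]_m -> 'M[R]_(p, q)) x v d :
  is_derive x v f d <->
  forall i j, is_derive x v (fun y => f y i j) (d i j).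
Proof.
split=> [[df <-] i j|H].
  by apply: DeriveDef; [exact: (derivable_mxP _ _ _).1|rewrite derive_mx // mxE].
have df : derivable f x v by apply/derivable_mxP => i j; case: (H i j).
by apply: DeriveDef => //; rewrite derive_mx //; apply/matrixP => i j; rewrite mxE;
   case: (H i j).
Qed.

Section Along.
Context {W : normedModType R}.
Implicit Types (f h : 'rV[R]_m -> W) (d : W).

Lemma has_dir_along u f x d : has_dir u f x d -> along (fun=> u) f x = d.
Proof. by case=> df Df ->; apply: eq_bigr => a _; have [_ ->] := Df a. Qed.

Lemma has_dir_eq u f x d d' : has_dir u f x d -> d = d' -> has_dir u f x d'.
Proof. by move=> H <-. Qed.

Lemma has_dir_uniq u f x d d' : has_dir u f x d -> has_dir u f x d' -> d = d'.
Proof. by move=> /has_dir_along <- /has_dir_along. Qed.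

Lemma derivable_has_dir u f x :
  (forall v, derivable f x v) -> has_dir u f x (along (fun=> u) f x).
Proof.
by move=> df; exists (fun a => 'D_(delta_mx 0 a) f x) => // a; exact: derivableP.
Qed.

Lemma smooth_derivable U f x v : smooth U f -> U x -> derivable f x v.
Proof. by move=> /(_ 1%N) [_ d _] Ux; exact: d. Qed.

Lemma smooth_continuous U f x : smooth U f -> U x -> {for x, continuous f}.
Proof. by move=> /(_ 0%N); apply. Qed.

Lemma smooth_derive U f v : smooth U f -> smooth U ('D_v f).
Proof. by move=> sf k; have [_ _] := sf k.+1; apply. Qed.

Lemma smooth_has_dir U u f x :
  smooth U f -> U x -> has_dir u f x (along (fun=> u) f x).
Proof. by move=> sf Ux; apply: derivable_has_dir => v; exact: smooth_derivable Ux. Qed.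

Lemma has_dir_cst u x (w : W) : has_dir u (fun=> w) x 0.
Proof.
exists (fun=> 0); first by move=> a; exact: is_derive_cst.
by rewrite big1 // => a _; rewrite scaler0.
Qed.

Lemma has_dirD u f h x d e :
  has_dir u f x d -> has_dir u h x e -> has_dir u (fun y => f y + h y) x (d + e).
Proof.
move=> [df Df ->] [dh Dh ->]; exists (fun a => df a + dh a).
  by move=> a; exact: is_deriveD.
by rewrite -big_split; apply: eq_bigr => a _; rewrite scalerDr.
Qed.

Lemma has_dirN u f x d : has_dir u f x d -> has_dir u (fun y => - f y) x (- d).
Proof.
move=> [df Df ->]; exists (fun a => - df a); first by move=> a; exact: is_deriveN.
by rewrite -sumrN; apply: eq_bigr => a _; rewrite scalerN.
Qed.

Lemma has_dirB u f h x d e :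
  has_dir u f x d -> has_dir u h x e -> has_dir u (fun y => f y - h y) x (d - e).
Proof. by move=> Df Dh; apply: has_dirD => //; exact: has_dirN. Qed.

Lemma has_dir_sum u (I : Type) (r : seq I) (F : I -> 'rV[R]_m -> W) x (d : I -> W) :
  (forall i, has_dir u (F i) x (d i)) ->
  has_dir u (fun y => \sum_(i <- r) F i y) x (\sum_(i <- r) d i).
Proof.
move=> H; elim: r => [|i r IH].
  by under eq_fun do rewrite big_nil; rewrite big_nil; exact: has_dir_cst.
by under eq_fun do rewrite big_cons; rewrite big_cons; exact: has_dirD.
Qed.

Lemma has_dirZ u (k : R) f x d :
  has_dir u f x d -> has_dir u (fun y => k *: f y) x (k *: d).
Proof.
move=> [df Df ->]; exists (fun a => k *: df a); first by move=> a; exact: is_deriveZ.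
by rewrite scaler_sumr; apply: eq_bigr => a _; rewrite !scalerA mulrC.
Qed.

Lemma near_eq_has_dir U u f h x d : open U -> U x -> {in U, f =1 h} ->
  has_dir u f x d -> has_dir u h x d.
Proof.
move=> Uo Ux fh [df Df ->]; exists df => // a.
apply: near_eq_is_derive (Df a); apply: filterS (open_nbhs_nbhs (conj Uo Ux)) => y Uy.
by apply: fh; rewrite inE.
Qed.

Lemma along_sum (I : Type) (r : seq I) (c : I -> R) (w : I -> 'rV[R]_m) f x :
  along (fun=> \sum_(i <- r) c i *: w i) f x = \sum_(i <- r) c i *: along (fun=> w i) f x.
Proof.
under [RHS]eq_bigr do rewrite scaler_sumr.
rewrite exchange_big; apply: eq_bigr => a _.
by rewrite summxE scaler_suml; apply: eq_bigr => i _; rewrite mxE scalerA.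
Qed.

End Along.

Section AlongMatrix.
Context {p q : nat}.

Lemma has_dir_mxP u (f : 'rV[R]_m -> 'M[R]_(p, q)) x d :
  has_dir u f x d <-> forall i j, has_dir u (fun y => f y i j) x (d i j).
Proof.
split=> [[df Df ->] i j|H].
  exists (fun a => df a i j); first by move=> a; exact: (is_derive_mxP _ _ _ _).1.
  by rewrite summxE; apply: eq_bigr => a _; rewrite mxE.
have Df a i j : is_derive x (delta_mx 0 a) (fun y => f y i j)
    ('D_(delta_mx 0 a) (fun y => f y i j) x).
  by have [df /(_ a) [Df _] _] := H i j; exact: derivableP.
exists (fun a => \matrix_(i, j) 'D_(delta_mx 0 a) (fun y => f y i j) x).
  by move=> a; apply/is_derive_mxP => i j; rewrite mxE.
apply/matrixP => i j; rewrite -(has_dir_along (H i j)) summxE.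
by apply: eq_bigr => a _; rewrite !mxE.
Qed.

End AlongMatrix.

Lemma has_dirM u (f h : 'rV[R]_m -> R) x d e :
  has_dir u f x d -> has_dir u h x e ->
  has_dir u (fun y => f y * h y) x (d * h x + f x * e).
Proof.
move=> [df Df ->] [dh Dh ->]; exists (fun a => df a * h x + f x * dh a).
  move=> a; have D := is_deriveM (Df a) (Dh a).
  by apply: is_derive_eq D _; rewrite [LHS]addrC mulrC.
rewrite mulr_suml mulr_sumr -big_split; apply: eq_bigr => a _ /=.
by rewrite /GRing.scale /=; ring.
Qed.

Lemma has_dir_mulmx p q r u (f : 'rV[R]_m -> 'M[R]_(p, q))
    (h : 'rV[R]_m -> 'M[R]_(q, r)) x d e :
  has_dir u f x d -> has_dir u h x e ->
  has_dir u (fun y => f y *m h y) x (d *m h x + f x *m e).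
Proof.
move=> /has_dir_mxP Df /has_dir_mxP Dh; apply/has_dir_mxP => i j.
under eq_fun do rewrite mxE; rewrite 3!mxE -big_split.
by apply: has_dir_sum => k; exact: has_dirM.
Qed.

Lemma has_dir_tr p q u (f : 'rV[R]_m -> 'M[R]_(p, q)) x d :
  has_dir u f x d -> has_dir u (fun y => (f y)^T) x d^T.
Proof.
move=> /has_dir_mxP Df; apply/has_dir_mxP => i j.
by under eq_fun do rewrite mxE; rewrite mxE.
Qed.

Lemma has_dir_scale p q u (k : 'rV[R]_m -> R) (f : 'rV[R]_m -> 'M[R]_(p, q)) x d e :
  has_dir u k x d -> has_dir u f x e ->
  has_dir u (fun y => k y *: f y) x (d *: f x + k x *: e).
Proof.
move=> Dk /has_dir_mxP Df; apply/has_dir_mxP => i j.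
by under eq_fun do rewrite mxE; rewrite 3!mxE; exact: has_dirM.
Qed.

Lemma has_dir_ev1 u (e : 'rV[R]_m -> 'cV[R]_m) X x d dX :
  has_dir u e x d -> has_dir u X x dX ->
  has_dir u (fun y => ev1 (e y) (X y)) x (ev1 d (X x) + ev1 (e x) dX).
Proof.
move=> De DX; have /has_dir_mxP/(_ 0 0) := has_dir_mulmx DX De.
by rewrite mxE addrC.
Qed.

Lemma has_dir_ev2 u (W : 'rV[R]_m -> 'M[R]_m) X Y x d dX dY :
  has_dir u W x d -> has_dir u X x dX -> has_dir u Y x dY ->
  has_dir u (fun y => ev2 (W y) (X y) (Y y)) x
    (ev2 d (X x) (Y x) + ev2 (W x) dX (Y x) + ev2 (W x) (X x) dY).
Proof.
move=> DW DX DY.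
have /has_dir_mxP/(_ 0 0) := has_dir_mulmx (has_dir_mulmx DX DW) (has_dir_tr DY).
by rewrite mulmxDl 2!mxE [X in X + _]addrC.
Qed.

Lemma smooth_along p q U u (f : 'rV[R]_m -> 'M[R]_(p, q)) v x :
  smooth U f -> U x ->
  has_dir u (fun y => along (fun=> v) f y) x
    (\sum_b v 0 b *: along (fun=> u) ('D_(delta_mx 0 b) f) x).
Proof.
move=> sf Ux; apply: has_dir_sum => b; apply: has_dirZ.
by apply: (smooth_has_dir (U := U)) => //; exact: smooth_derive.
Qed.

Lemma near_eq_continuous (W : topologicalType) (f h : 'rV[R]_m -> W) x :
  (\forall z \near x, f z = h z) -> {for x, continuous f} -> {for x, continuous h}.
Proof.
move=> fh; rewrite /prop_for /continuous_at -(nbhs_singleton fh) => cf.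
exact: cvg_trans (near_eq_cvg fh) cf.
Qed.

Lemma derive_mx_comm p q U (f : 'rV[R]_m -> 'M[R]_(p, q)) x v w :
  open U -> smooth U f -> U x -> 'D_w ('D_v f) x = 'D_v ('D_w f) x.
Proof.
move=> Uo sf Ux.
have entry1 v' i j y : U y ->
    is_derive y v' (fun z => f z i j) ('D_v' f y i j).
  by move=> Uy; apply: (is_derive_mxP _ _ _ _).1; apply/derivableP;
     exact: smooth_derivable Uy.
have entry2 v' w' i j y : U y ->
    is_derive y w' ('D_v' (fun z => f z i j)) ('D_w' ('D_v' f) y i j).
  move=> Uy.
  have : is_derive y w' (fun z => 'D_v' f z i j) ('D_w' ('D_v' f) y i j).
    apply: (is_derive_mxP _ _ _ _).1; apply/derivableP.
    by apply: (smooth_derivable (U := U)) => //; exact: smooth_derive.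
  apply: near_eq_is_derive; apply: filterS (open_nbhs_nbhs (conj Uo Uy)) => z Uz.
  by have [_ ->] := entry1 v' i j z Uz.
have cont v' w' i j : {for x, continuous ('D_w' ('D_v' (fun z => f z i j)))}.
  have : {for x, continuous (fun z => 'D_w' ('D_v' f) z i j)}.
    apply: (@continuous_comp _ _ _ _ (fun N : 'M[R]_(p, q) => N i j)).
      apply: (smooth_continuous (U := U)) => //.
      by do 2 apply: smooth_derive.
    exact: coord_continuous.
  apply: near_eq_continuous; apply: filterS (open_nbhs_nbhs (conj Uo Ux)) => z Uz.
  by have [_ E] := entry2 v' w' i j z Uz; exact: esym E.
apply/matrixP => i j.
have [_ E1] := entry2 v w i j x Ux; have [_ E2] := entry2 w v i j x Ux.
apply: etrans (esym E1) _; apply: etrans _ E2.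
apply: (derive_comm Uo Ux _ _ _ _ (cont v w i j) (cont w v i j)).
- by move=> y Uy; have [] := entry1 v i j y Uy.
- by move=> y Uy; have [] := entry1 w i j y Uy.
- by move=> y Uy; have [] := entry2 v w i j y Uy.
- by move=> y Uy; have [] := entry2 w v i j y Uy.
Qed.

Lemma along_comm p q U (f : 'rV[R]_m -> 'M[R]_(p, q)) x u v :
  open U -> smooth U f -> U x ->
  along (fun=> u) (fun y => along (fun=> v) f y) x =
  along (fun=> v) (fun y => along (fun=> u) f y) x.
Proof.
move=> Uo sf Ux.
rewrite (has_dir_along (smooth_along u v sf Ux)) (has_dir_along (smooth_along v u sf Ux)).
suff sym (F : 'I_m -> 'I_m -> 'M[R]_(p, q)) : (forall a b, F a b = F b a) ->
    \sum_b v 0 b *: (\sum_a u 0 a *: F a b) = \sum_b u 0 b *: (\sum_a v 0 a *: F a b).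
  by apply: sym => a b; exact: (derive_mx_comm _ _ Uo sf Ux).
move=> symF; under eq_bigr do rewrite scaler_sumr.
rewrite exchange_big; apply: eq_bigr => a _; rewrite scaler_sumr.
by apply: eq_bigr => b _; rewrite !scalerA mulrC symF.
Qed.

End DirectionalDerivatives.

(** * Even permutations of three indices *)
Section EvenTriples.
Implicit Types (i j k : 'I_3).

(** The even permutations of three letters are the powers of the cycle. *)
Lemma even3E i j k : even3 i j k <-> j = ordS i /\ k = ordS j.
Proof.
split.
  case=> s [os -> -> ->].
  have d01 : s 0 != s 1 by rewrite (inj_eq perm_inj).
  have d02 : s 0 != s 2 by rewrite (inj_eq perm_inj).
  have d12 : s 1 != s 2 by rewrite (inj_eq perm_inj).
  have odd_case a b : a != b -> s a = b -> s b = a ->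
      (forall d, d != a -> d != b -> s d = d) -> False.
    move=> ab sa sb sd; move: os; rewrite (_ : s = tperm a b) ?odd_tperm ?ab //.
    apply/permP => d; have [->|da] := eqVneq d a; first by rewrite tpermL.
    have [->|db] := eqVneq d b; first by rewrite tpermR.
    by rewrite tpermD 1?eq_sym ?sd.
  have I3 (d : 'I_3) : [\/ d = 0, d = 1 | d = 2].
    by case: d => -[|[|[|//]]] p; [constructor 1|constructor 2|constructor 3];
       apply/val_inj.
  suff H a b d : s 0 = a -> s 1 = b -> s 2 = d -> b = ordS a /\ d = ordS b by exact: H.
  move=> s0 s1 s2; move: d01 d02 d12; rewrite s0 s1 s2.
  have [] := I3 a => Ea; have [] := I3 b => Eb; have [] := I3 d => Ed;
    rewrite Ea Eb Ed // => _ _ _; (try by split; apply/val_inj); exfalso;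
    rewrite {}Ea {}Eb {}Ed in s0 s1 s2.
  - by apply: (odd_case 1 2) => // l; have [] := I3 l => ->.
  - by apply: (odd_case 0 1) => // l; have [] := I3 l => ->.
  - by apply: (odd_case 0 2) => // l; have [] := I3 l => ->.
case=> -> ->.
case: i => -[|[|[|//]]] p.
- by exists (1%g : 'S_3); rewrite odd_perm1 !perm1; split=> //; apply/val_inj.
- exists (tperm 0%R 1%R * tperm 0%R 2%R)%g; rewrite odd_permM !odd_tperm !permM; split => //.
  + by rewrite tpermL tpermD //; apply/val_inj.
  + by rewrite tpermR tpermL; apply/val_inj.
  + by rewrite (@tpermD _ 0 1) // tpermR; apply/val_inj.
- exists (tperm 0%R 2%R * tperm 0%R 1%R)%g; rewrite odd_permM !odd_tperm !permM; split => //.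
  + by rewrite tpermL tpermD //; apply/val_inj.
  + by rewrite (@tpermD _ 0 2) // tpermR; apply/val_inj.
  + by rewrite tpermR tpermL; apply/val_inj.
Qed.

Lemma ordS3 i : ordS (ordS (ordS i)) = i.
Proof. by case: i => -[|[|[|//]]] p; apply/val_inj. Qed.

Lemma even3_rot i j k : even3 i j k -> even3 j k i.
Proof. by rewrite !even3E => -[-> ->]; rewrite ordS3. Qed.

Lemma even3_ordS i : even3 i (ordS i) (ordS (ordS i)).
Proof. by rewrite even3E. Qed.

Lemma even3_neq i j k : even3 i j k -> [/\ i != j, j != k & i != k].
Proof. by rewrite even3E => -[-> ->]; case: i => -[|[|[|//]]] p. Qed.

Lemma even3_cases i j k l : even3 i j k -> [\/ l = i, l = j | l = k].
Proof.
rewrite even3E => -[-> ->].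
case: i l => -[|[|[|//]]] p [[|[|[|//]]] q];
  by [constructor 1; apply/val_inj|constructor 2; apply/val_inj|constructor 3; apply/val_inj].
Qed.

Lemma sum_even3 (V : nmodType) (F : 'I_3 -> V) i j k :
  even3 i j k -> \sum_l F l = F i + F j + F k.
Proof.
move=> e; have [ij jk ik] := even3_neq e.
rewrite (bigD1 i) //= (bigD1 j) 1?eq_sym //= (bigD1 k) /=; last by rewrite ![k == _]eq_sym ik jk.
rewrite big1 ?addr0 ?addrA // => l /andP[/andP[li lj] lk].
by have [] := even3_cases l e => E; move: li lj lk; rewrite E eqxx.
Qed.

End EvenTriples.

(** * Linear algebra at a point *)
Section PointwiseAlgebra.
Context {R : realType} {m : nat}.
Implicit Types (u v w : 'rV[R]_m) (e : 'cV[R]_m) (W A B : 'M[R]_m).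

Lemma eq_mulrow n (A B : 'M[R]_(m, n)) : (forall u, u *m A = u *m B) -> A = B.
Proof. by move=> H; apply/row_matrixP => i; rewrite !rowE. Qed.

Lemma ev1P (e e' : 'cV[R]_m) : (forall u, ev1 e u = ev1 e' u) -> e = e'.
Proof.
move=> H; apply: eq_mulrow => u; rewrite [LHS]mx11_scalar [RHS]mx11_scalar.
by congr _%:M; exact: H.
Qed.

Lemma ev2P (W W' : 'M[R]_m) : (forall u v, ev2 W u v = ev2 W' u v) -> W = W'.
Proof.
move=> H; apply/matrixP => a b; have := H (delta_mx 0 a) (delta_mx 0 b).
by rewrite /ev2 trmx_delta -!rowE -!colE !mxE.
Qed.

Lemma mul_row_col u e : u *m e = (ev1 e u)%:M.
Proof. exact: mx11_scalar. Qed.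

Lemma mul_row_outer u e v : u *m (e *m v) = ev1 e u *: v.
Proof. by rewrite mulmxA mul_row_col mul_scalar_mx. Qed.

Lemma ev1D e u v : ev1 e (u + v) = ev1 e u + ev1 e v.
Proof. by rewrite /ev1 mulmxDl mxE. Qed.
Lemma ev1N e u : ev1 e (- u) = - ev1 e u.
Proof. by rewrite /ev1 mulNmx mxE. Qed.
Lemma ev1Z e (k : R) u : ev1 e (k *: u) = k * ev1 e u.
Proof. by rewrite /ev1 -scalemxAl mxE. Qed.
Lemma ev1_mul A e u : ev1 (A *m e) u = ev1 e (u *m A).
Proof. by rewrite /ev1 mulmxA. Qed.
Lemma ev1Dl e e' u : ev1 (e + e') u = ev1 e u + ev1 e' u.
Proof. by rewrite /ev1 mulmxDr mxE. Qed.
Lemma ev1Nl e u : ev1 (- e) u = - ev1 e u.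
Proof. by rewrite /ev1 mulmxN mxE. Qed.
Lemma ev1Zl e (k : R) u : ev1 (k *: e) u = k * ev1 e u.
Proof. by rewrite /ev1 -scalemxAr mxE. Qed.

Lemma ev2Dl W u u' v : ev2 W (u + u') v = ev2 W u v + ev2 W u' v.
Proof. by rewrite /ev2 !mulmxDl mxE. Qed.
Lemma ev2Nl W u v : ev2 W (- u) v = - ev2 W u v.
Proof. by rewrite /ev2 !mulNmx mxE. Qed.
Lemma ev2Zl W (k : R) u v : ev2 W (k *: u) v = k * ev2 W u v.
Proof. by rewrite /ev2 -!scalemxAl mxE. Qed.
Lemma ev2Dr W u v v' : ev2 W u (v + v') = ev2 W u v + ev2 W u v'.
Proof. by rewrite /ev2 linearD mulmxDr mxE. Qed.
Lemma ev2Nr W u v : ev2 W u (- v) = - ev2 W u v.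
Proof. by rewrite /ev2 linearN mulmxN mxE. Qed.
Lemma ev2Zr W (k : R) u v : ev2 W u (k *: v) = k * ev2 W u v.
Proof. by rewrite /ev2 linearZ -scalemxAr mxE. Qed.
Lemma ev2D W W' u v : ev2 (W + W') u v = ev2 W u v + ev2 W' u v.
Proof. by rewrite /ev2 mulmxDr mulmxDl mxE. Qed.
Lemma ev2N W u v : ev2 (- W) u v = - ev2 W u v.
Proof. by rewrite /ev2 mulmxN mulNmx mxE. Qed.
Lemma ev2Z W (k : R) u v : ev2 (k *: W) u v = k * ev2 W u v.
Proof. by rewrite /ev2 -scalemxAr -scalemxAl mxE. Qed.
Lemma ev2_mul A B W u v : ev2 (A *m W *m B^T) u v = ev2 W (u *m A) (v *m B).
Proof. by rewrite /ev2 trmx_mul !mulmxA. Qed.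
Lemma ev2_mull A W u v : ev2 (A *m W) u v = ev2 W (u *m A) v.
Proof. by rewrite /ev2 !mulmxA. Qed.
Lemma ev2_mulr B W u v : ev2 (W *m B^T) u v = ev2 W u (v *m B).
Proof. by rewrite /ev2 trmx_mul !mulmxA. Qed.
Lemma ev2_tr W u v : ev2 W^T u v = ev2 W v u.
Proof. by rewrite /ev2 -[v *m W *m u^T]trmxK [RHS]mxE !trmx_mul !trmxK mulmxA. Qed.
Lemma ev2_ev1 W u v : ev2 W u v = ev1 (W *m v^T) u.
Proof. by rewrite /ev2 /ev1 mulmxA. Qed.

Definition ev2E := (ev2Dl, ev2Nl, ev2Zl, ev2Dr, ev2Nr, ev2Zr).
Definition ev1E := (ev1D, ev1N, ev1Z).

(** Identities between non-commutative products are checked entrywise: after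
    expansion the entries of the products are atoms, and [mxDE], [mxNE] and [mxZE],
    unlike [mxE], leave these products folded. *)
Lemma mxDE p q (A B : 'M[R]_(p, q)) a b : (A + B) a b = A a b + B a b.
Proof. by rewrite mxE. Qed.

Lemma mxNE p q (A : 'M[R]_(p, q)) a b : (- A) a b = - A a b.
Proof. by rewrite mxE. Qed.

Lemma mxZE p q c (A : 'M[R]_(p, q)) a b : (c *: A) a b = c * A a b.
Proof. by rewrite mxE. Qed.

Lemma tr_outer (A : 'M[R]_m) (e : 'cV[R]_m) u : \tr (A *m (e *m u)) = ev1 e (u *m A).
Proof. by rewrite mulmxA mxtrace_mulC mulmxA trace_mx11. Qed.

Lemma skewE (A : 'M[R]_m) a b : Defs.skew A -> A b a = - A a b.
Proof. by move=> As; have := congr1 (fun B : 'M[R]_m => B a b) As; rewrite !mxE. Qed.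

Lemma ev2_delta (W : 'M[R]_m) c d : ev2 W (delta_mx 0 c) (delta_mx 0 d) = W c d.
Proof. by rewrite /ev2 trmx_delta -rowE -colE !mxE. Qed.

Lemma inner2_sum (g0 P B : 'M[R]_m) : g0^T = g0 ->
  inner2 g0 P B = 2^-1 * \sum_c \sum_d B c d * (g0 *m P *m g0) c d.
Proof.
move=> gs; rewrite /inner2; congr (_ * _).
rewrite mxtrace_mulC !mulmxA (_ : g0 *m P^T *m g0 = (g0 *m P *m g0)^T); last first.
  by rewrite !trmx_mul gs mulmxA.
rewrite /mxtrace; under eq_bigr do rewrite mxE.
rewrite exchange_big; apply: eq_bigr => c _; apply: eq_bigr => d _.
by rewrite mxE mulrC.
Qed.

Lemma inner2C (g0 A B : 'M[R]_m) : g0^T = g0 -> inner2 g0 A B = inner2 g0 B A.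
Proof.
move=> gs; rewrite /inner2 -[in LHS]mxtrace_tr !trmx_mul trmxK gs.
by rewrite mxtrace_mulC !mulmxA.
Qed.

Lemma exchange_big4 (F : 'I_m -> 'I_m -> 'I_m -> 'I_m -> R) :
  \sum_c \sum_d \sum_a \sum_b F c d a b = \sum_a \sum_b \sum_c \sum_d F c d a b.
Proof.
transitivity (\sum_c \sum_a \sum_b \sum_d F c d a b).
  apply: eq_bigr => c _; rewrite exchange_big; apply: eq_bigr => a _.
  by rewrite exchange_big.
by rewrite exchange_big; apply: eq_bigr => a _; rewrite exchange_big.
Qed.

Lemma mxtrace_affine_mul (A B P Q : 'M[R]_m) a b :
  \tr ((- A + a *: P) *m (- B + b *: Q)) =
  \tr (A *m B) - b * \tr (A *m Q) - a * \tr (P *m B) + a * b * \tr (P *m Q).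
Proof.
rewrite mulmxDl !mulmxDr !mulNmx !mulmxN opprK -!scalemxAl -!scalemxAr scalerA.
rewrite 2!mxtraceD mxtraceD !(raddfN (mxtrace : 'M[R]_m -> R)) /= !mxtraceZ; ring.
Qed.

(** The almost 3-contact relations at a point as matrix identities.  Endomorphisms
    act on the right, which is why the factors appear in the reverse order. *)
Record contact3_at (phi : 'I_3 -> 'M[R]_m) (xi : 'I_3 -> 'rV[R]_m)
    (eta : 'I_3 -> 'cV[R]_m) (g : 'M[R]_m) : Prop := Contact3At {
  c3_g : posdef_sym g;
  c3_phi_mul : forall i j k, even3 i j k ->
    phi j *m phi i = phi k + eta j *m xi i;
  c3_phi_mulN : forall i j k, even3 i j k ->
    phi i *m phi j = - phi k + eta i *m xi j;
  c3_phi_sqr : forall i, phi i *m phi i = - 1%:M + eta i *m xi i;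
  c3_xi_phi : forall i, xi i *m phi i = 0;
  c3_xi_phil : forall i j k, even3 i j k -> xi j *m phi i = xi k;
  c3_xi_phir : forall i j k, even3 i j k -> xi i *m phi j = - xi k;
  c3_phi_eta : forall i, phi i *m eta i = 0;
  c3_phi_etar : forall i j k, even3 i j k -> phi j *m eta i = eta k;
  c3_phi_etal : forall i j k, even3 i j k -> phi i *m eta j = - eta k;
  c3_eta_xi : forall i j, ev1 (eta i) (xi j) = (i == j)%:R;
  c3_eta : forall i, eta i = g *m (xi i)^T;
  c3_phi_g : forall i, phi i *m g = - (g *m (phi i)^T) }.

(** Compatibility of phi_i with g gives, with xi_i as second argument, that eta_i
    is the metric dual of xi_i, and with phi_i v as second argument that phi_i is
    skew. *)
Lemma contact3_atP (M : manifold R m) phi xi eta g (c : charts M) x :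
  almost_3_contact_metric phi xi eta g -> img c x ->
  contact3_at (fun i => phi i c x) (fun i => xi i c x) (fun i => eta i c x) (g c x).
Proof.
move=> [A P X E] cx; rewrite /app in P X.
have sqr i : phi i c x *m phi i c x = - 1%:M + eta i c x *m xi i c x.
  apply: eq_mulrow => u; rewrite mulmxDr mulmxN mulmx1 mul_row_outer mulmxA.
  exact: acm_sqr (A i) _ _ _ cx.
have xi_phi i : xi i c x *m phi i c x = 0 by exact: acm_phi_xi (A i) _ _ cx.
have phi_eta i : phi i c x *m eta i c x = 0.
  by apply: ev1P => u; rewrite ev1_mul (acm_eta_phi (A i)) // /ev1 mulmx0 mxE.
have [_ _ /(_ c x cx) gp] := acm_g (A 0).
have [gs _] := gp.
have S u v : ev2 (g c x) u v = ev2 (g c x) v u by rewrite -ev2_tr gs.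
have eta_g i : eta i c x = g c x *m (xi i c x)^T.
  apply: ev1P => u; rewrite -ev2_ev1.
  have := acm_compat (A i) u (xi i c x) cx.
  have Z w : ev2 (g c x) w 0 = 0 by rewrite /ev2 trmx0 mulmx0 mxE.
  by rewrite /app xi_phi Z (acm_eta_xi (A i)) // mulr1 => /esym/eqP;
     rewrite subr_eq0 => /eqP ->.
have eta_phi i u : ev1 (eta i c x) (u *m phi i c x) = 0.
  exact: acm_eta_phi (A i) _ _ _ cx.
split=> //.
- move=> i j k e; have := P i j k c x _ e cx => {}P.
  apply: eq_mulrow => u; have [-> _] := P u.
  by rewrite mulmxDr (P u).1 mul_row_outer mulmxA subrK.
- move=> i j k e; have := P i j k c x _ e cx => {}P.
  apply: eq_mulrow => u.
  by rewrite mulmxDr mulmxN (P u).2 mul_row_outer opprD opprK mulmxA subrK.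
- by move=> i j k e; have [<- _] := X i j k c x e cx.
- by move=> i j k e; have [_ ->] := X i j k c x e cx; rewrite opprK.
- move=> i j k e; apply: ev1P => u; rewrite ev1_mul.
  by have [-> _] := E i j k c x u e cx.
- move=> i j k e; apply: ev1P => u; rewrite ev1_mul ev1Nl.
  by have [_ ->] := E i j k c x u e cx; rewrite opprK.
- move=> i; have e := even3_ordS i.
  move: (ordS i) (ordS (ordS i)) e => j k e l; have [ij jk ik] := even3_neq e.
  have [E1 _] := E j k i c x (xi k c x) (even3_rot e) cx.
  have [_ E2] := E j k i c x (xi j c x) (even3_rot e) cx.
  have [->|->|->] := even3_cases l e; first by rewrite eqxx (acm_eta_xi (A i)).
    by rewrite (negPf ij) E2 /app xi_phi /ev1 mul0mx mxE oppr0.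
  by rewrite (negPf ik) E1 /app xi_phi /ev1 mul0mx mxE.
- move=> i; apply: ev2P => u v; rewrite ev2_mull ev2N ev2_mulr.
  have := acm_compat (A i) u (v *m phi i c x) cx.
  rewrite /app eta_phi mulr0 subr0 -mulmxA sqr mulmxDr mulmxN mulmx1 mul_row_outer.
  rewrite ev2Dr ev2Nr ev2Zr [ev2 _ _ (xi i c x)]ev2_ev1 -eta_g eta_phi mulr0 addr0.
  by move=> <-; rewrite opprK.
Qed.

End PointwiseAlgebra.

(** * The structure in a chart *)
Section CanonicalLocal.
Context {R : realType} {m : nat} (U : set 'rV[R]_m).
Context (phi : 'I_3 -> 'rV[R]_m -> 'M[R]_m) (xi : 'I_3 -> 'rV[R]_m -> 'rV[R]_m)
  (eta : 'I_3 -> 'rV[R]_m -> 'cV[R]_m) (g : 'rV[R]_m -> 'M[R]_m)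
  (G : 'rV[R]_m -> 'I_m -> 'M[R]_m) (alpha delta beta : R).
Implicit Types (x u v w z : 'rV[R]_m).

(** The matrix of v |-> nabla_u v on constant fields; [tors] is then the torsion. *)
Definition conn_mx x u : 'M[R]_m := \sum_a u 0 a *: G x a.

Lemma christoffelE x u v : christoffel (G x) u v = v *m conn_mx x u.
Proof. by rewrite /conn_mx mulmx_sumr; apply: eq_bigr => a _; rewrite -scalemxAr. Qed.

Lemma conn_mxD x u v : conn_mx x (u + v) = conn_mx x u + conn_mx x v.
Proof. by rewrite -big_split; apply: eq_bigr => a _; rewrite mxE scalerDl. Qed.

Lemma conn_mxZ x (k : R) u : conn_mx x (k *: u) = k *: conn_mx x u.
Proof. by rewrite scaler_sumr; apply: eq_bigr => a _; rewrite mxE scalerA. Qed.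

Definition tors x u v : 'rV[R]_m := v *m conn_mx x u - u *m conn_mx x v.

Definition Phi_at i x : 'M[R]_m := g x *m (phi i x)^T.
(** The infinitesimal rotation by which the canonical connection moves each of the
    triples phi, xi, eta and Phi. *)
Definition rotation (T : lmodType R) (t : 'I_3 -> T) j k x u : T :=
  beta *: (ev1 (eta k x) u *: t j - ev1 (eta j x) u *: t k).

Lemma rotation_tr p q (t : 'I_3 -> 'M[R]_(p, q)) j k x u :
  (rotation t j k x u)^T = rotation (fun i => (t i)^T) j k x u.
Proof. by apply/matrixP => a b; rewrite !mxE. Qed.

Lemma rotation_mull p q r (A : 'M[R]_(r, p)) (t : 'I_3 -> 'M[R]_(p, q)) j k x u :
  A *m rotation t j k x u = rotation (fun i => A *m t i) j k x u.
Proof. by rewrite -scalemxAr mulmxBr -!scalemxAr. Qed.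

(** The covariant derivatives of phi_i and g are encoded as formulas for their
    coordinate derivatives, the form in which the product rule uses them. *)
Record canonical_local : Prop := CanonicalLocal {
  cl_open : open U;
  cl_alpha : alpha != 0;
  cl_beta : beta = 2 * (delta - 2 * alpha);
  cl_phi : forall i, smooth U (phi i);
  cl_xi : forall i, smooth U (xi i);
  cl_eta : forall i, smooth U (eta i);
  cl_g : smooth U g;
  cl_G : forall a, smooth U (fun x => G x a);
  cl_contact : forall x, U x ->
    contact3_at (phi^~ x) (xi^~ x) (eta^~ x) (g x);
  cl_dphi : forall i j k x u, even3 i j k -> U x ->
    has_dir u (phi i) x
      (conn_mx x u *m phi i x - phi i x *m conn_mx x u + rotation (phi^~ x) j k x u);
  cl_dg : forall x u, U x ->
    has_dir u g x (conn_mx x u *m g x + g x *m (conn_mx x u)^T);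
  cl_tors : forall x u v w, U x ->
    ev2 (g x) (tors x u v) w = - ev2 (g x) (tors x u w) v;
  cl_deta : forall i j k x u v, even3 i j k -> U x ->
    ev1 (along (fun=> u) (eta i) x) v - ev1 (along (fun=> v) (eta i) x) u =
    2 * alpha * ev2 (Phi_at i x) u v +
    2 * (alpha - delta) *
      (ev1 (eta j x) u * ev1 (eta k x) v - ev1 (eta k x) u * ev1 (eta j x) v) }.

Context (H : canonical_local).

(** Differentiating phi_i xi_i = 0 determines phi_i (nabla xi_i), hence nabla xi_i up
    to a multiple of xi_i, and this multiple vanishes because xi_i has length 1. *)
Lemma dir_xi i j k x u : even3 i j k -> U x ->
  has_dir u (xi i) x (- (xi i x *m conn_mx x u) + rotation (xi^~ x) j k x u).
Proof.
move=> e Ux; have Uo := cl_open H; have C := cl_contact H Ux.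
have Dxi := smooth_has_dir u (cl_xi H i) Ux; apply: has_dir_eq (Dxi) _.
set d := along _ _ _ in Dxi *.
have e1 := even3_rot e; have e2 := even3_rot e1.
have P : d *m phi i x + xi i x *m (conn_mx x u *m phi i x - phi i x *m conn_mx x u
     + rotation (phi^~ x) j k x u) = 0.
  apply: has_dir_uniq (has_dir_mulmx Dxi (cl_dphi H u e Ux)) _.
  apply: (near_eq_has_dir Uo Ux) (has_dir_cst u x 0) => y /[!inE] Uy.
  by rewrite (c3_xi_phi (cl_contact H Uy)).
(* the covariant derivative of xi_i *)
pose n := d + xi i x *m conn_mx x u.
have n_eta : ev1 (eta i x) n = 0.
  have E : ev2 (conn_mx x u *m g x + g x *m (conn_mx x u)^T) (xi i x) (xi i x) +
     ev2 (g x) d (xi i x) + ev2 (g x) (xi i x) d = 0.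
    apply: has_dir_uniq (has_dir_ev2 (cl_dg H u Ux) Dxi Dxi) _.
    apply: (near_eq_has_dir (W := R) Uo Ux) (has_dir_cst (W := R) u x 1) => y /[!inE] Uy.
    have Cy := cl_contact H Uy.
    by rewrite ev2_ev1 -(c3_eta Cy) (c3_eta_xi Cy) eqxx.
  have [gs _] := c3_g C.
  have S a b : ev2 (g x) a b = ev2 (g x) b a by rewrite -ev2_tr gs.
  move: E; rewrite ev2D ev2_mull ev2_mulr ![ev2 _ (xi i x) _]S.
  rewrite !ev2_ev1 -(c3_eta C) /n ev1D => E.
  by apply: (@mulfI _ 2) => //; rewrite mulr0 -[RHS]E; ring.
have n_phi : n *m phi i x = beta *: (ev1 (eta k x) u *: xi k x + ev1 (eta j x) u *: xi j x).
  apply/eqP; rewrite -subr_eq0 -P; apply/eqP.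
  rewrite /n mulmxDl mulmxDr mulmxBr !mulmxA (c3_xi_phi C) mul0mx subr0.
  rewrite /rotation -scalemxAr mulmxBr -!scalemxAr.
  rewrite (c3_xi_phir C e) (c3_xi_phil C e2).
  by rewrite -addrA -scalerN opprD scalerN.
have : n *m phi i x *m phi i x = - n.
  by rewrite -mulmxA (c3_phi_sqr C) mulmxDr mulmxN mulmx1 mul_row_outer n_eta scale0r addr0.
rewrite n_phi -scalemxAl mulmxDl -!scalemxAl (c3_xi_phir C e2) (c3_xi_phil C e).
move=> /(congr1 -%R); rewrite opprK -scalerN opprD -!scalerN opprK => nE.
rewrite -[d](addrK (xi i x *m conn_mx x u)) -/n -nE addrC.
by rewrite scalerN.
Qed.

Lemma dir_eta i j k x u : even3 i j k -> U x ->
  has_dir u (eta i) x (conn_mx x u *m eta i x + rotation (eta^~ x) j k x u).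
Proof.
move=> e Ux; have Uo := cl_open H; have C := cl_contact H Ux.
have D := has_dir_mulmx (cl_dg H u Ux) (has_dir_tr (dir_xi u e Ux)).
have {}D := has_dir_eq D.
apply: (near_eq_has_dir Uo Ux) (D _ _) => [y /[!inE] Uy|].
  by rewrite (c3_eta (cl_contact H Uy)).
rewrite linearD linearN /= rotation_tr trmx_mul mulmxDr rotation_mull.
rewrite mulmxDl mulmxN !mulmxA -addrA addNKr -!mulmxA -(c3_eta C).
by rewrite /rotation -!(c3_eta C).
Qed.

Lemma dir_Phi i j k x u : even3 i j k -> U x ->
  has_dir u (Phi_at i) x (conn_mx x u *m Phi_at i x + Phi_at i x *m (conn_mx x u)^T
    + rotation (Phi_at^~ x) j k x u).
Proof.
move=> e Ux; have D := has_dir_mulmx (cl_dg H u Ux) (has_dir_tr (cl_dphi H u e Ux)).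
apply: has_dir_eq D _.
rewrite linearD linearB /= rotation_tr !trmx_mul mulmxDr mulmxBr rotation_mull.
rewrite mulmxDl !mulmxA /Phi_at.
by rewrite [X in _ + (X + _)]addrC !addrA addrK.
Qed.

(** * The torsion *)
Lemma metric_sym x u v : U x -> ev2 (g x) u v = ev2 (g x) v u.
Proof. by move=> Ux; have [gs _] := c3_g (cl_contact H Ux); rewrite -ev2_tr gs. Qed.

Lemma metric_xi x u i : U x -> ev2 (g x) u (xi i x) = ev1 (eta i x) u.
Proof. by move=> Ux; rewrite ev2_ev1 -(c3_eta (cl_contact H Ux)). Qed.

Lemma metric_inj x u v : U x -> (forall w, ev2 (g x) u w = ev2 (g x) v w) -> u = v.
Proof.
move=> Ux E; have [gs gp] := c3_g (cl_contact H Ux).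
apply/eqP; rewrite -subr_eq0; apply: contraT => /gp.
by rewrite ev2Dl ev2Nl E subrr ltxx.
Qed.

Lemma Phi_atE x i u v : ev2 (Phi_at i x) u v = ev2 (g x) u (v *m phi i x).
Proof. by rewrite ev2_mulr. Qed.

Lemma Phi_at_skew x i u v : U x -> ev2 (Phi_at i x) u v = - ev2 (Phi_at i x) v u.
Proof.
move=> Ux; rewrite -[ev2 _ v u]ev2_tr -ev2N; congr (ev2 _ u v).
rewrite /Phi_at trmx_mul trmxK; have [gs _] := c3_g (cl_contact H Ux).
by rewrite gs (c3_phi_g (cl_contact H Ux)) opprK.
Qed.

Lemma Phi_at_xi x i u : U x -> ev2 (Phi_at i x) u (xi i x) = 0.
Proof.
by move=> Ux; rewrite Phi_atE (c3_xi_phi (cl_contact H Ux)) /ev2 trmx0 mulmx0 mxE.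
Qed.

Lemma Phi_at_xil x i j k u : even3 i j k -> U x ->
  ev2 (Phi_at i x) u (xi j x) = ev1 (eta k x) u.
Proof.
by move=> e Ux; rewrite Phi_atE (c3_xi_phil (cl_contact H Ux) e) metric_xi.
Qed.

Lemma Phi_at_xir x i j k u : even3 i j k -> U x ->
  ev2 (Phi_at j x) u (xi i x) = - ev1 (eta k x) u.
Proof.
by move=> e Ux; rewrite Phi_atE (c3_xi_phir (cl_contact H Ux) e) ev2Nr metric_xi.
Qed.

Lemma tors_skew x u v : tors x u v = - tors x v u.
Proof. by rewrite /tors opprB. Qed.

Definition tors3 x u v w := ev2 (g x) (tors x u v) w.

Lemma tors3_skewl x u v w : tors3 x u v w = - tors3 x v u w.
Proof. by rewrite /tors3 tors_skew ev2Nl. Qed.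

Lemma tors3_skewr x u v w : U x -> tors3 x u v w = - tors3 x u w v.
Proof. by move=> Ux; exact: cl_tors H _ _ _ _ Ux. Qed.

Lemma tors3_rot x u v w : U x -> tors3 x u v w = tors3 x v w u.
Proof. by move=> Ux; rewrite tors3_skewl tors3_skewr // opprK. Qed.

Lemma torsN x u v : tors x (- u) v = - tors x u v.
Proof.
by rewrite /tors -[- u]scaleN1r conn_mxZ !scaleN1r mulmxN mulNmx opprB opprK addrC.
Qed.

(** Torsion is the difference between d eta_i and the alternation of nabla eta_i,
    which [dir_eta] provides. *)
Lemma tors_eta i j k x u v : even3 i j k -> U x ->
  ev1 (eta i x) (tors x u v) = 2 * alpha * ev2 (Phi_at i x) u v +
   (2 * delta - 6 * alpha) *
     (ev1 (eta j x) u * ev1 (eta k x) v - ev1 (eta k x) u * ev1 (eta j x) v).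
Proof.
move=> e Ux; have := cl_deta H u v e Ux.
rewrite !(has_dir_along (dir_eta _ e Ux)) /rotation.
rewrite !(ev1Dl, ev1Zl, ev1Nl, ev1_mul) (cl_beta H) /tors ev1D ev1N => E.
apply: (@addrI _ (- (2 * alpha * ev2 (Phi_at i x) u v +
    2 * (alpha - delta) *
      (ev1 (eta j x) u * ev1 (eta k x) v - ev1 (eta k x) u * ev1 (eta j x) v)))).
rewrite -{1}E; ring.
Qed.

Definition horizontal x u := forall l, ev1 (eta l x) u = 0.

(** This is d (d eta_i) = 0: the cyclic sum of the derivatives of the components of
    d eta_i cancels in pairs by symmetry of second derivatives. *)
Lemma second_derivatives_eta i x u v w : U x ->
  exists d : 'rV[R]_m -> 'rV[R]_m -> 'rV[R]_m -> R,
    (forall a b c, has_dir (W := R) a (fun y => ev1 (along (fun=> b) (eta i) y) c -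
       ev1 (along (fun=> c) (eta i) y) b) x (d a b c)) /\
    d w u v + d u v w + d v w u = 0.
Proof.
move=> Ux.
pose D a b := along (fun=> a) (fun y => along (fun=> b) (eta i) y) x.
have DC a b : D a b = D b a by exact: along_comm (cl_open H) (cl_eta H i) Ux.
exists (fun a b c => ev1 (D a b) c - ev1 (D a c) b); split=> [a b c|].
  have HD b' c' : has_dir (W := R) a (fun y => ev1 (along (fun=> b') (eta i) y) c') x (ev1 (D a b') c').
    have HA : has_dir a (fun y => along (fun=> b') (eta i) y) x (D a b').
      have HA := smooth_along a b' (cl_eta H i) Ux.
      by rewrite /D (has_dir_along HA).
    have := has_dir_ev1 HA (has_dir_cst a x c').
    by move=> /has_dir_eq; apply; rewrite /ev1 mul0mx [X in _ + X]mxE addr0.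
  exact: has_dirB.
by clearbody D; rewrite (DC w u) (DC w v) (DC u v); ring.
Qed.

(** Both sides of the formula for d eta_i are differentiated.  On horizontal vectors
    the derivatives of eta_j /\ eta_k vanish and so does the rotation of Phi_i, so
    closedness leaves the cyclic sum of Phi_i(T(w,u),v), that is, the derivation
    phi_i applied to the torsion form. *)
Lemma tors3_phi_horizontal i x u v w : U x ->
  horizontal x u -> horizontal x v -> horizontal x w ->
  tors3 x (u *m phi i x) v w + tors3 x u (v *m phi i x) w +
  tors3 x u v (w *m phi i x) = 0.
Proof.
move=> Ux hu hv hw; have e := even3_ordS i; move: (ordS i) (ordS (ordS i)) e => j k e.
have ej := even3_rot e; have ek := even3_rot ej.
have [d [Dd]] := second_derivatives_eta i u v w Ux.
have dE a b c : horizontal x a -> horizontal x b -> horizontal x c ->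
  d a b c = 2 * alpha * (ev2 (Phi_at i x) (b *m conn_mx x a) c + ev2 (Phi_at i x) b (c *m conn_mx x a)).
  move=> ha hb hc.
  have DF := has_dir_ev2 (dir_Phi a e Ux) (has_dir_cst a x b) (has_dir_cst a x c).
  have Dj s := has_dir_ev1 (dir_eta a ej Ux) (has_dir_cst a x s).
  have Dk s := has_dir_ev1 (dir_eta a ek Ux) (has_dir_cst a x s).
  have D := has_dirD (has_dirZ (2 * alpha) DF) (has_dirZ (2 * (alpha - delta))
     (has_dirB (has_dirM (Dj b) (Dk c)) (has_dirM (Dk b) (Dj c)))).
  apply: (has_dir_uniq (Dd a b c)).
  have {}D := has_dir_eq D.
  apply: (near_eq_has_dir (W := R) (cl_open H) Ux) (D _ _).
    by move=> y /[!inE] Uy; rewrite (cl_deta H b c e Uy).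
  have Z (f : 'cV[R]_m) : ev1 f 0 = 0 by rewrite /ev1 mul0mx mxE.
  have Zl (f : 'M[R]_m) s : ev2 f 0 s = 0 by rewrite /ev2 !mul0mx mxE.
  have Zr (f : 'M[R]_m) s : ev2 f s 0 = 0 by rewrite /ev2 trmx0 mulmx0 mxE.
  rewrite Zl Zr !Z /rotation !(ha _) !(hb _) !(hc _) !scale0r subrr scaler0 !addr0.
  rewrite !mulr0 !mul0r !addr0 subrr scaler0 addr0.
  by rewrite ev2D ev2_mull ev2_mulr.
rewrite !dE // -!mulrDr => /eqP; rewrite mulf_eq0 mulf_eq0 (negPf (cl_alpha H)) pnatr_eq0 /= => /eqP E.
have E2 : ev2 (Phi_at i x) (tors x w u) v + ev2 (Phi_at i x) (tors x u v) w +
    ev2 (Phi_at i x) (tors x v w) u = 0.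
  rewrite -[RHS]E /tors !ev2Dl !ev2Nl.
  rewrite [ev2 _ u (v *m _)]Phi_at_skew // [ev2 _ v (w *m _)]Phi_at_skew //.
  by rewrite [ev2 _ w (u *m _)]Phi_at_skew //; ring.
rewrite -[RHS]E2 !Phi_atE -!/(tors3 _ _ _ _).
rewrite (tors3_rot (u *m _)) // -(tors3_rot _ u) //; ring.
Qed.

Lemma horizontal_phi i x u : U x -> horizontal x u -> horizontal x (u *m phi i x).
Proof.
move=> Ux hu l; rewrite -ev1_mul; have C := cl_contact H Ux.
have e := even3_ordS i; move: (ordS i) (ordS (ordS i)) e => j k e.
have [->|->|->] := even3_cases l e.
- by rewrite (c3_phi_eta C) /ev1 mulmx0 mxE.
- by rewrite (c3_phi_etal C e) ev1Nl hu oppr0.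
- by rewrite (c3_phi_etar C (even3_rot (even3_rot e))) hu.
Qed.

Lemma horizontal_phi2 i x u : U x -> horizontal x u -> u *m phi i x *m phi i x = - u.
Proof.
move=> Ux hu; rewrite -mulmxA (c3_phi_sqr (cl_contact H Ux)) mulmxDr mulmxN mulmx1.
by rewrite mul_row_outer hu scale0r addr0.
Qed.

Lemma tors3N1 x u v w : tors3 x (- u) v w = - tors3 x u v w.
Proof. by rewrite /tors3 torsN ev2Nl. Qed.

(** J = phi_0 squares to - id on horizontal vectors.  Replacing one of the three
    arguments by its image under J in [tors3_phi_horizontal], and solving, gives
    T(a,b,c) = 2 T(Ja,Jb,c); used twice, T(u,v,w) = 4 T(u,v,w). *)
Lemma tors3_horizontal x u v w : U x ->
  horizontal x u -> horizontal x v -> horizontal x w -> tors3 x u v w = 0.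
Proof.
move=> Ux; pose J u := u *m phi 0 x.
have hJ u' : horizontal x u' -> horizontal x (J u') by exact: horizontal_phi.
have JJ u' : horizontal x u' -> J (J u') = - u' by exact: horizontal_phi2.
have half a b c : horizontal x a -> horizontal x b -> horizontal x c ->
    tors3 x a b c = 2 * tors3 x (J a) (J b) c.
  move=> ha hb hc.
  have := tors3_phi_horizontal 0 Ux (hJ _ ha) hb hc.
  have := tors3_phi_horizontal 0 Ux ha (hJ _ hb) hc.
  have := tors3_phi_horizontal 0 Ux ha hb (hJ _ hc).
  rewrite -!/(J _) !JJ // tors3N1 [tors3 x a (- b) c]tors3_skewl tors3N1.
  rewrite [tors3 x a b (- c)]tors3_skewr // [tors3 x a (- c) b]tors3_skewl tors3N1.
  rewrite [tors3 x c a b]tors3_skewl [tors3 x a c b]tors3_skewr // [tors3 x b a c]tors3_skewl.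
  by lra.
move=> hu hv hw; have := half u v w hu hv hw.
rewrite (half _ _ w (hJ _ hu) (hJ _ hv) hw) !JJ // tors3N1.
by rewrite [tors3 x u (- v) w]tors3_skewl tors3N1 [tors3 x v u w]tors3_skewl; lra.
Qed.

Definition dconn_mx x u v : 'M[R]_m := along (fun=> u) (fun y => conn_mx y v) x.

Lemma dir_conn_mx x u v : U x -> has_dir u (fun y => conn_mx y v) x (dconn_mx x u v).
Proof.
move=> Ux; have D : has_dir u (fun y => conn_mx y v) x
    (\sum_a v 0 a *: along (fun=> u) (fun y => G y a) x).
  by apply: has_dir_sum => a; apply: has_dirZ; exact: smooth_has_dir (cl_G H a) Ux.
by rewrite /dconn_mx (has_dir_along D).
Qed.

Lemma dir_tors x u v z : U x ->
  has_dir z (fun y => tors y u v) x (v *m dconn_mx x z u - u *m dconn_mx x z v).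
Proof.
move=> Ux; have D (a b : 'rV[R]_m) : has_dir z (fun y => a *m conn_mx y b) x (a *m dconn_mx x z b).
  apply: has_dir_eq (has_dir_mulmx (has_dir_cst z x a) (dir_conn_mx z b Ux)) _.
  by move: (dconn_mx _ _ _) => d; rewrite mul0mx add0r.
exact: has_dirB (D v u) (D u v).
Qed.

Section TorsionForm.

Context (i j k : 'I_3) (e : even3 i j k).

Definition eta_wedge_Phi l x u v w :=
  ev1 (eta l x) u * ev2 (Phi_at l x) v w + ev1 (eta l x) v * ev2 (Phi_at l x) w u
  + ev1 (eta l x) w * ev2 (Phi_at l x) u v.

Definition det_eta x u v w :=
  ev1 (eta i x) u * (ev1 (eta j x) v * ev1 (eta k x) w - ev1 (eta k x) v * ev1 (eta j x) w)
  + ev1 (eta i x) v * (ev1 (eta j x) w * ev1 (eta k x) u - ev1 (eta k x) w * ev1 (eta j x) u)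
  + ev1 (eta i x) w * (ev1 (eta j x) u * ev1 (eta k x) v - ev1 (eta k x) u * ev1 (eta j x) v).

(** The 3-form 2 alpha sum_l eta_l /\ Phi_l + 2 (delta - alpha) eta_i /\ eta_j /\ eta_k. *)
Definition torsion_form x u v w : R :=
  2 * alpha * (eta_wedge_Phi i x u v w + eta_wedge_Phi j x u v w + eta_wedge_Phi k x u v w)
  + 2 * (delta - alpha) * det_eta x u v w.

Lemma torsion_form_rot x u v w : torsion_form x u v w = torsion_form x v w u.
Proof. by rewrite /torsion_form /eta_wedge_Phi /det_eta; ring. Qed.

Lemma torsion_formB x u v w w' :
  torsion_form x u v (w - w') = torsion_form x u v w - torsion_form x u v w'.
Proof. by rewrite /torsion_form /eta_wedge_Phi /det_eta !ev2E !ev1E; ring. Qed.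

Lemma torsion_formZ x u v w c : torsion_form x u v (c *: w) = c * torsion_form x u v w.
Proof. by rewrite /torsion_form /eta_wedge_Phi /det_eta !ev2E !ev1E; ring. Qed.

Let ej := even3_rot e.
Let ek := even3_rot ej.

Lemma torsion_form_xi l x u v : U x -> torsion_form x u v (xi l x) = tors3 x u v (xi l x).
Proof.
move=> Ux; have C := cl_contact H Ux; have [ij jk ik] := even3_neq e.
rewrite /tors3 metric_xi // /torsion_form /eta_wedge_Phi /det_eta.
rewrite ![ev2 _ (xi l x) u](Phi_at_skew _ (xi l x) u Ux).
have [->|->|->] := even3_cases l e.
- rewrite (tors_eta u v e Ux) !(c3_eta_xi C) eqxx ![_ == i]eq_sym (negPf ij) (negPf ik).
  rewrite !Phi_at_xi // !(Phi_at_xir _ e) // !(Phi_at_xil _ ek) //.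
  by rewrite mulr1n !mulr0n; ring.
- rewrite (tors_eta u v ej Ux) !(c3_eta_xi C) eqxx [k == j]eq_sym (negPf ij) (negPf jk).
  rewrite !Phi_at_xi // !(Phi_at_xir _ ej) // !(Phi_at_xil _ e) //.
  by rewrite mulr1n !mulr0n; ring.
- rewrite (tors_eta u v ek Ux) !(c3_eta_xi C) eqxx (negPf jk) (negPf ik).
  rewrite !Phi_at_xi // !(Phi_at_xir _ ek) // !(Phi_at_xil _ ej) //.
  by rewrite mulr1n !mulr0n; ring.
Qed.

(** The difference of the two alternating forms vanishes as soon as one argument is
    some xi_l, so that its arguments may be replaced by their horizontal parts,
    where both forms vanish. *)
Lemma tors3E x u v w : U x -> tors3 x u v w = torsion_form x u v w.
Proof.
move=> Ux; have C := cl_contact H Ux; have [ij jk ik] := even3_neq e.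
pose hor a := a - ev1 (eta i x) a *: xi i x - ev1 (eta j x) a *: xi j x - ev1 (eta k x) a *: xi k x.
have hor_hor a : horizontal x (hor a).
  move=> l; rewrite /hor !ev1E; have [->|->|->] := even3_cases l e;
  by rewrite !(c3_eta_xi C) ?eqxx ?[j == i]eq_sym ?[k == i]eq_sym ?[k == j]eq_sym
    ?(negPf ij) ?(negPf ik) ?(negPf jk) /= ?mulr1n ?mulr0n; ring.
pose s a b c := tors3 x a b c - torsion_form x a b c.
have s_rot a b c : s a b c = s b c a.
  by rewrite /s tors3_rot // torsion_form_rot.
have s_hor a b c : s a b (hor c) = s a b c.
  rewrite /s /hor !torsion_formB !torsion_formZ !torsion_form_xi //.
  rewrite /tors3 !ev2E; ring.
apply/eqP; rewrite -subr_eq0 -/(s u v w) -s_hor -s_rot -s_rot -s_hor -s_rot -s_rot -s_hor.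
rewrite /s tors3_horizontal // /torsion_form /eta_wedge_Phi /det_eta !hor_hor.
by apply/eqP; ring.
Qed.

Lemma dir_ev1_eta l q r x z a : even3 l q r -> U x ->
  has_dir (W := R) z (fun y => ev1 (eta l y) a) x
    (ev1 (eta l x) (a *m conn_mx x z) +
     beta * (ev1 (eta r x) z * ev1 (eta q x) a - ev1 (eta q x) z * ev1 (eta r x) a)).
Proof.
move=> e' Ux; apply: has_dir_eq (has_dir_ev1 (dir_eta z e' Ux) (has_dir_cst z x a)) _.
by rewrite /rotation !(ev1Dl, ev1Zl, ev1Nl, ev1_mul) /ev1 mul0mx [X in _ + X]mxE addr0.
Qed.

Lemma dir_ev2_Phi l q r x z a b : even3 l q r -> U x ->
  has_dir (W := R) z (fun y => ev2 (Phi_at l y) a b) x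
    (ev2 (Phi_at l x) (a *m conn_mx x z) b + ev2 (Phi_at l x) a (b *m conn_mx x z) +
     beta * (ev1 (eta r x) z * ev2 (Phi_at q x) a b - ev1 (eta q x) z * ev2 (Phi_at r x) a b)).
Proof.
move=> e' Ux.
apply: has_dir_eq (has_dir_ev2 (dir_Phi z e' Ux) (has_dir_cst z x a) (has_dir_cst z x b)) _.
rewrite /rotation !(ev2D, ev2Z, ev2N) ev2_mull ev2_mulr.
have -> : ev2 (Phi_at l x) 0 b = 0 by rewrite /ev2 !mul0mx mxE.
have -> : ev2 (Phi_at l x) a 0 = 0 by rewrite /ev2 trmx0 mulmx0 mxE.
by rewrite !addr0.
Qed.

(** The torsion is parallel: [rotation] acts on eta and Phi simultaneously, and the
    contributions of the rotations to the derivative of [torsion_form] cancel. *)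
Lemma parallel_torsion x u v z : U x ->
  (v *m dconn_mx x z u - u *m dconn_mx x z v) + tors x u v *m conn_mx x z =
  tors x (u *m conn_mx x z) v + tors x u (v *m conn_mx x z).
Proof.
move=> Ux; set dT := _ - _; apply: (metric_inj Ux) => w.
have DT : has_dir z (fun y => tors y u v) x dT by exact: dir_tors.
have Dt := has_dir_ev2 (cl_dg H z Ux) DT (has_dir_cst z x w).
pose De l q r a e' := @dir_ev1_eta l q r x z a e' Ux.
pose DP l q r a b e' := @dir_ev2_Phi l q r x z a b e' Ux.
have Dcyc l q r (e' : even3 l q r) :=
  has_dirD (has_dirD (has_dirM (De _ _ _ u e') (DP _ _ _ v w e'))
                     (has_dirM (De _ _ _ v e') (DP _ _ _ w u e')))
           (has_dirM (De _ _ _ w e') (DP _ _ _ u v e')).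
have Dpair a b := has_dirB (has_dirM (De _ _ _ a ej) (De _ _ _ b ek))
                           (has_dirM (De _ _ _ a ek) (De _ _ _ b ej)).
have Ddet := has_dirD (has_dirD (has_dirM (De _ _ _ u e) (Dpair v w))
                                (has_dirM (De _ _ _ v e) (Dpair w u)))
                      (has_dirM (De _ _ _ w e) (Dpair u v)).
have DF := has_dirD (has_dirZ (2 * alpha)
    (has_dirD (has_dirD (Dcyc _ _ _ e) (Dcyc _ _ _ ej)) (Dcyc _ _ _ ek)))
                    (has_dirZ (2 * (delta - alpha)) Ddet).
have E := has_dir_uniq Dt (near_eq_has_dir (W := R) (cl_open H) Ux _ DF).
have {}E := E (fun y yU => esym (tors3E u v w (set_mem yU))).
have Z : ev2 (g x) (tors x u v) 0 = 0 by rewrite /ev2 trmx0 mulmx0 mxE.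
cbv beta in E; rewrite ev2D ev2_mull ev2_mulr Z addr0 in E.
have F a b w' : ev2 (g x) (tors x a b) w' = torsion_form x a b w' by exact: tors3E.
rewrite [LHS]ev2Dl [RHS]ev2Dl !F; rewrite F in E.
apply: (@addrI _ (torsion_form x u v (w *m conn_mx x z))).
transitivity (ev2 (g x) (tors x u v *m conn_mx x z) w +
    torsion_form x u v (w *m conn_mx x z) + ev2 (g x) dT w); first by ring.
by rewrite E /torsion_form /eta_wedge_Phi /det_eta /GRing.scale /=; ring.
Qed.

End TorsionForm.

(** * Curvature *)

(** The matrix of the curvature endomorphism R(u,v); on constant fields the bracket
    term is zero. *)
Definition curv_mx x u v : 'M[R]_m :=
  dconn_mx x u v - dconn_mx x v u + conn_mx x v *m conn_mx x u - conn_mx x u *m conn_mx x v.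

Lemma curv_mx_skew x u v : curv_mx x u v = - curv_mx x v u.
Proof.
rewrite /curv_mx; move: (dconn_mx x u v) (dconn_mx x v u) (_ *m _) (_ *m _) => a b c d.
by rewrite !opprD !opprK [- b + a]addrC -!addrA [- c + d]addrC.
Qed.

Lemma tors_additive x u v v' : tors x u (v + v') = tors x u v + tors x u v'.
Proof. by rewrite /tors conn_mxD mulmxDl mulmxDr opprD addrACA. Qed.

(** In the cyclic sum the derivatives of the connection matrices combine into
    covariant derivatives of T applied to constant fields, which
    [parallel_torsion] expresses by T and the connection. *)
Lemma first_Bianchi x u v w : U x ->
  w *m curv_mx x u v + u *m curv_mx x v w + v *m curv_mx x w u =
  tors x (tors x u v) w + tors x (tors x v w) u + tors x (tors x w u) v.
Proof.
move=> Ux; have P a b c : (b *m dconn_mx x c a - a *m dconn_mx x c b) + tors x a b *m conn_mx x c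
    = tors x (a *m conn_mx x c) b + tors x a (b *m conn_mx x c).
  exact: (parallel_torsion (even3_ordS 0)).
have addl a a' b : tors x (a + a') b = tors x a b + tors x a' b.
  by rewrite tors_skew tors_additive opprD -!tors_skew.
have subl a a' b : tors x (a - a') b = tors x a b - tors x a' b by rewrite addl torsN.
transitivity (tors x (v *m conn_mx x u) w + tors x v (w *m conn_mx x u) +
  (tors x (w *m conn_mx x v) u + tors x w (u *m conn_mx x v)) +
  (tors x (u *m conn_mx x w) v + tors x u (v *m conn_mx x w))).
  rewrite -!P /curv_mx /tors; move: (conn_mx x) (dconn_mx x) => ga dga.
  rewrite !(mulmxDr, mulmxDl, mulmxN, mulNmx) -!mulmxA.
  apply/matrixP => a b; rewrite !(mxDE, mxNE); ring.
rewrite [in RHS]/(tors x u v) [in RHS]/(tors x v w) [in RHS]/(tors x w u) !subl.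
rewrite [tors x v (w *m _)]tors_skew [tors x w (u *m _)]tors_skew [tors x u (v *m _)]tors_skew.
move: (tors x) (conn_mx x) => T ga.
by apply/matrixP => a b; rewrite !(mxDE, mxNE); ring.
Qed.

(** Commute two covariant derivatives of the parallel tensor g. *)
Lemma curv_mx_metric x u v : U x -> curv_mx x u v *m g x = - (g x *m (curv_mx x u v)^T).
Proof.
move=> Ux; have Uo := cl_open H.
have D a b : along (fun=> a) (fun y => along (fun=> b) g y) x =
    dconn_mx x a b *m g x + conn_mx x b *m (conn_mx x a *m g x + g x *m (conn_mx x a)^T)
    + ((conn_mx x a *m g x + g x *m (conn_mx x a)^T) *m (conn_mx x b)^T + g x *m (dconn_mx x a b)^T).
  apply: has_dir_along; have Dg := cl_dg H a Ux; have DG := dir_conn_mx a b Ux.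
  apply: (near_eq_has_dir Uo Ux _ (has_dirD (has_dir_mulmx DG Dg)
    (has_dir_mulmx Dg (has_dir_tr DG)))) => y /[!inE] Uy.
  by rewrite (has_dir_along (cl_dg H b Uy)).
have := along_comm u v Uo (cl_g H) Ux; rewrite !D => E.
move/eqP: E; rewrite -subr_eq0 => /eqP E.
apply/eqP; rewrite -addr_eq0; apply/eqP; apply: etrans _ E; rewrite /curv_mx.
have trD (A B : 'M[R]_m) : (A + B)^T = A^T + B^T by rewrite linearD.
have trN (A : 'M[R]_m) : (- A)^T = - A^T by rewrite linearN.
move: (conn_mx x) (dconn_mx x) (g x) => ga dga gx.
rewrite !(trD, trN) !trmx_mul !(mulmxDr, mulmxDl, mulmxN, mulNmx) !mulmxA.
by apply/matrixP => a b; rewrite !(mxDE, mxNE); ring.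
Qed.

(** The components of the 2-form Phi_i - eta_j /\ eta_k. *)
Definition Psi i j k x u v : R :=
  ev2 (Phi_at i x) u v - (ev1 (eta j x) u * ev1 (eta k x) v - ev1 (eta k x) u * ev1 (eta j x) v).

(** Commute two covariant derivatives of phi_i.  The coefficient of phi_j is
    d eta_k plus a quadratic term in eta, written through [tors_eta]; the value of
    beta makes it a multiple of [Psi]. *)
Lemma curv_mx_phi i j k x u v : even3 i j k -> U x ->
  phi i x *m curv_mx x u v - curv_mx x u v *m phi i x =
  (2 * alpha * beta) *: (Psi k i j x u v *: phi j x - Psi j k i x u v *: phi k x).
Proof.
move=> e Ux; have Uo := cl_open H; have ej := even3_rot e; have ek := even3_rot ej.
(* q a is the covariant derivative of phi_i along a; dq a b is the coordinate
   derivative along a of the covariant derivative along b *)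
pose q a := rotation (phi^~ x) j k x a.
pose dq a b : 'M[R]_m :=
  beta *: (((ev1 (eta k x) (b *m conn_mx x a) + beta * (ev1 (eta j x) a * ev1 (eta i x) b
              - ev1 (eta i x) a * ev1 (eta j x) b)) *: phi j x +
            ev1 (eta k x) b *: (conn_mx x a *m phi j x - phi j x *m conn_mx x a
              + rotation (phi^~ x) k i x a)) -
           ((ev1 (eta j x) (b *m conn_mx x a) + beta * (ev1 (eta i x) a * ev1 (eta k x) b
              - ev1 (eta k x) a * ev1 (eta i x) b)) *: phi k x +
            ev1 (eta j x) b *: (conn_mx x a *m phi k x - phi k x *m conn_mx x a
              + rotation (phi^~ x) i j x a))).
have Dq a b : has_dir a (fun y => rotation (phi^~ y) j k y b) x (dq a b).
  apply: has_dirZ; apply: has_dirB; apply: has_dir_scale;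
    by [exact: dir_ev1_eta | exact: (cl_dphi H)].
have D a b : along (fun=> a) (fun y => along (fun=> b) (phi i) y) x =
    (dconn_mx x a b *m phi i x + conn_mx x b *m (conn_mx x a *m phi i x - phi i x *m conn_mx x a + q a))
    - ((conn_mx x a *m phi i x - phi i x *m conn_mx x a + q a) *m conn_mx x b + phi i x *m dconn_mx x a b)
    + dq a b.
  apply: has_dir_along; have Dp := cl_dphi H a e Ux; have DG := dir_conn_mx a b Ux.
  apply: (near_eq_has_dir Uo Ux _ (has_dirD (has_dirB (has_dir_mulmx DG Dp)
    (has_dir_mulmx Dp DG)) (Dq a b))) => y /[!inE] Uy.
  by rewrite (has_dir_along (cl_dphi H b e Uy)).
have := along_comm u v Uo (cl_phi H i) Ux; rewrite !D => E.
transitivity ((dq u v - conn_mx x u *m q v + q v *m conn_mx x u) -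
    (dq v u - conn_mx x v *m q u + q u *m conn_mx x v)).
  move/eqP: E; rewrite -subr_eq0 => /eqP /(congr1 -%R); rewrite oppr0 => E.
  apply/eqP; rewrite -subr_eq0; apply/eqP; apply: etrans _ E.
  move: (dq u v) (dq v u) (q u) (q v) => d1 d2 q1 q2.
  rewrite /curv_mx; move: (conn_mx x) (dconn_mx x) (phi i x) => ga dga ph.
  rewrite !(mulmxDr, mulmxDl, mulmxN, mulNmx) !mulmxA.
  by apply/matrixP => a b; rewrite !(mxDE, mxNE); ring.
have tE l r s e' : _ = _ := @tors_eta l r s x u v e' Ux.
have Ek := tE _ _ _ ek; have Ej := tE _ _ _ ej; clear tE.
rewrite /tors !ev1D !ev1N in Ek Ej.
rewrite /q /dq /rotation /Psi !(mulmxDr, mulmxDl, mulmxN, mulNmx, =^~ scalemxAr, =^~ scalemxAl).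
apply/matrixP => a b; rewrite !(mxDE, mxNE, mxZE).
have Ek' : ev1 (eta k x) (v *m conn_mx x u) = ev1 (eta k x) (u *m conn_mx x v) +
   (2 * alpha * ev2 (Phi_at k x) u v + (2 * delta - 6 * alpha) *
     (ev1 (eta i x) u * ev1 (eta j x) v - ev1 (eta j x) u * ev1 (eta i x) v)).
  by rewrite -Ek; ring.
have Ej' : ev1 (eta j x) (v *m conn_mx x u) = ev1 (eta j x) (u *m conn_mx x v) +
   (2 * alpha * ev2 (Phi_at j x) u v + (2 * delta - 6 * alpha) *
     (ev1 (eta k x) u * ev1 (eta i x) v - ev1 (eta i x) u * ev1 (eta k x) v)).
  by rewrite -Ej; ring.
by rewrite Ek' Ej' (cl_beta H); ring.
Qed.

Lemma curv_mx_skew34 x u v w z : U x ->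
  ev2 (g x) (w *m curv_mx x u v) z = - ev2 (g x) (z *m curv_mx x u v) w.
Proof.
by move=> Ux; rewrite -[LHS]ev2_mull curv_mx_metric // ev2N ev2_mulr metric_sym.
Qed.

(** The argument that deduces pair symmetry from a vanishing cyclic sum applies
    to a cyclic sum that is a 4-form: of the four Bianchi identities obtained by
    cyclically permuting the arguments, the right-hand sides agree up to the sign
    of the permutation and cancel. *)
Lemma curv_mx_pair x u v w z : U x ->
  ev2 (g x) (w *m curv_mx x u v) z = ev2 (g x) (u *m curv_mx x w z) v.
Proof.
move=> Ux.
pose r a b c d := ev2 (g x) (c *m curv_mx x a b) d.
pose T2 a b c d := ev2 (g x) (tors x a b) (tors x c d).
have r12 a b c d : r a b c d = - r b a c d by rewrite /r curv_mx_skew mulmxN ev2Nl.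
have r34 a b c d : r a b c d = - r a b d c by exact: curv_mx_skew34.
have T12 a b c d : T2 a b c d = - T2 b a c d by rewrite /T2 tors_skew ev2Nl.
have T34 a b c d : T2 a b c d = - T2 a b d c by rewrite /T2 [tors x c d]tors_skew ev2Nr.
have TS a b c d : T2 a b c d = T2 c d a b by exact: (metric_sym _ _ Ux).
have tT a b c d : ev2 (g x) (tors x (tors x a b) c) d = T2 a b c d.
  by rewrite TS; exact: (tors3_rot _ c d Ux).
have E3 a b c d : ev2 (g x) (a + b + c) d = ev2 (g x) a d + ev2 (g x) b d + ev2 (g x) c d.
  by rewrite !ev2Dl.
have B a b c d : r a b c d + r b c a d + r c a b d = T2 a b c d + T2 b c a d + T2 c a b d.
  have := congr1 (fun t => ev2 (g x) t d) (first_Bianchi a b c Ux) => /=.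
  by rewrite (E3 (c *m curv_mx x a b)) (E3 (tors x (tors x a b) c)) !tT.
rewrite -/(r u v w z) -/(r w z u v); clearbody r T2.
have B1 := B u v w z; have B2 := B v w z u; have B3 := B w z u v; have B4 := B z u v w.
rewrite (r34 v w z u) (r34 w z v u) (r12 z v w u) in B2.
rewrite (r12 z u w v) (r34 u z w v) (r12 u w z v) (r34 w u z v) in B3.
rewrite (r12 z u v w) (r34 u v z w) (r34 v z u w) in B4.
rewrite (T34 v w z u) (T34 w z v u) (TS w z u v) (TS z v w u) (T34 w u z v) in B2.
rewrite (TS w z u v) (TS z u w v) (T12 w v z u) (T34 v w z u) (T12 u w z v) (T34 w u z v) in B3.
rewrite (TS z u v w) (T34 v w z u) (T34 u v z w) (TS v z u w) (T12 u w v z) in B4.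
by lra.
Qed.

Lemma conn_mx_sum x (c : 'I_m -> R) :
  conn_mx x (\sum_a c a *: delta_mx 0 a) = \sum_a c a *: conn_mx x (delta_mx 0 a).
Proof.
rewrite /conn_mx; under [RHS]eq_bigr do rewrite scaler_sumr.
rewrite exchange_big; apply: eq_bigr => b _.
by rewrite summxE scaler_suml; apply: eq_bigr => a _; rewrite mxE scalerA.
Qed.

Lemma dconn_mx_suml x (c : 'I_m -> R) u :
  dconn_mx x (\sum_a c a *: delta_mx 0 a) u = \sum_a c a *: dconn_mx x (delta_mx 0 a) u.
Proof. exact: along_sum. Qed.

Lemma dconn_mx_sumr x (c : 'I_m -> R) u : U x ->
  dconn_mx x u (\sum_a c a *: delta_mx 0 a) = \sum_a c a *: dconn_mx x u (delta_mx 0 a).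
Proof.
move=> Ux; apply: has_dir_along.
have D := has_dir_sum (index_enum 'I_m) (fun a => has_dirZ (c a) (dir_conn_mx u (delta_mx 0 a) Ux)).
by under eq_fun do rewrite conn_mx_sum.
Qed.

Lemma curv_mx_sumr x u v : U x -> curv_mx x u v = \sum_b v 0 b *: curv_mx x u (delta_mx 0 b).
Proof.
move=> Ux; rewrite {1}(row_sum_delta v) /curv_mx dconn_mx_sumr // dconn_mx_suml conn_mx_sum.
rewrite mulmx_suml mulmx_sumr -sumrB -big_split -sumrB; apply: eq_bigr => b _ /=.
by rewrite -scalemxAl -scalemxAr !scalerBr scalerDr scalerBr.
Qed.

Lemma curv_mx_sum x u v : U x ->
  curv_mx x u v = \sum_a \sum_b (u 0 a * v 0 b) *: curv_mx x (delta_mx 0 a) (delta_mx 0 b).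
Proof.
move=> Ux; rewrite curv_mx_skew curv_mx_sumr // -sumrN; apply: eq_bigr => a _.
rewrite curv_mx_skew scalerN opprK curv_mx_sumr // scaler_sumr; apply: eq_bigr => b _.
by rewrite scalerA.
Qed.

(** The terms with derivatives of X and Y cancel against the bracket term, and the
    second derivatives of Z cancel by symmetry. *)
Lemma curvatureE X Y Z x : smooth U X -> smooth U Y -> smooth U Z -> U x ->
  curvature G X Y Z x = Z x *m curv_mx x (X x) (Y x).
Proof.
move=> sX sY sZ Ux; have Uo := cl_open H.
pose cov v y := along (fun=> v) Z y + Z y *m conn_mx y v.
have cov_sum (c : 'I_m -> R) y : cov (\sum_b c b *: delta_mx 0 b) y = \sum_b c b *: cov (delta_mx 0 b) y.
  rewrite /cov along_sum conn_mx_sum mulmx_sumr -big_split; apply: eq_bigr => b _ /=.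
  by rewrite scalerDr -scalemxAr.
have covE (v : 'rV[R]_m) y : cov v y = \sum_b v 0 b *: cov (delta_mx 0 b) y.
  by rewrite {1}(row_sum_delta v) cov_sum.
have nablaE X' Y' y : nabla G X' Y' y = along (fun=> X' y) Y' y + Y' y *m conn_mx y (X' y).
  by rewrite /nabla christoffelE.
have D (V : 'rV[R]_m -> 'rV[R]_m) u : smooth U V ->
  has_dir u (fun y => nabla G V Z y) x (cov (along (fun=> u) V x) x +
   (along (fun=> u) (fun y => along (fun=> V x) Z y) x +
    (along (fun=> u) Z x *m conn_mx x (V x) + Z x *m dconn_mx x u (V x)))).
  move=> sV; have DV := smooth_has_dir u sV Ux; have DZ := smooth_has_dir u sZ Ux.
  have Dc b : has_dir u (cov (delta_mx 0 b)) x
    (along (fun=> u) (fun y => along (fun=> delta_mx 0 b) Z y) x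
     + (along (fun=> u) Z x *m conn_mx x (delta_mx 0 b) + Z x *m dconn_mx x u (delta_mx 0 b))).
    apply: has_dirD; last exact: has_dir_mulmx DZ (dir_conn_mx _ _ Ux).
    by have DD := smooth_along u (delta_mx 0 b) sZ Ux; rewrite (has_dir_along DD).
  have Db b : has_dir u (fun y => V y 0 b *: cov (delta_mx 0 b) y) x _ :=
    has_dir_scale ((has_dir_mxP _ _ _ _).1 DV 0 b) (Dc b).
  have {}D := has_dir_sum (index_enum 'I_m) Db.
  have E : (fun y => nabla G V Z y) = (fun y => \sum_b V y 0 b *: cov (delta_mx 0 b) y).
    by apply/funext => y; rewrite nablaE -/(cov (V y) y) covE.
  rewrite E; apply: has_dir_eq D _; rewrite big_split; congr (_ + _).
    by rewrite -covE.
  under eq_bigr do rewrite 2!scalerDr.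
  rewrite !big_split /=; congr (_ + (_ + _)).
  - rewrite [RHS](has_dir_along (smooth_along u (V x) sZ Ux)); apply: eq_bigr => b _.
    rewrite (has_dir_along (smooth_along u (delta_mx 0 b) sZ Ux)); congr (_ *: _).
    rewrite (bigD1 b) //= big1 ?addr0 ?mxE ?eqxx ?scale1r // => a ab.
    by rewrite mxE (negPf ab) andbF scale0r.
  - rewrite {2}(row_sum_delta (V x)) conn_mx_sum mulmx_sumr; apply: eq_bigr => b _.
    by rewrite -scalemxAr.
  - rewrite {2}(row_sum_delta (V x)) dconn_mx_sumr // mulmx_sumr; apply: eq_bigr => b _.
    by rewrite -scalemxAr.
have covB u v : cov (u - v) x = cov u x - cov v x.
  rewrite !covE -sumrB; apply: eq_bigr => b _; by rewrite !mxE scalerBl.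
have E2 V W : smooth U W -> nabla G V (nabla G W Z) x =
    cov (along (fun=> V x) W x) x +
    (along (fun=> V x) (fun y => along (fun=> W x) Z y) x +
      (along (fun=> V x) Z x *m conn_mx x (W x)
      + Z x *m dconn_mx x (V x) (W x))) +
    (along (fun=> W x) Z x + Z x *m conn_mx x (W x)) *m conn_mx x (V x).
  by move=> sW; rewrite nablaE (has_dir_along (D _ _ sW)) nablaE.
have EB : nabla G (bracket X Y) Z x =
    cov (along (fun=> X x) Y x) x - cov (along (fun=> Y x) X x) x.
  by rewrite nablaE -covB.
rewrite /curvature EB (E2 X Y sY) (E2 Y X sX).
have := along_comm (X x) (Y x) Uo sZ Ux.
move: (cov _ x) (cov _ x) (along (fun=> X x) (fun _ => _) x) (along (fun=> Y x) (fun _ => _) x).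
move: (along (fun=> X x) Z x) (along (fun=> Y x) Z x) => a1 a2 c1 c2 s1 s2 ->.
rewrite /curv_mx; move: (dconn_mx x) (conn_mx x) (X x) (Y x) (Z x) => dga ga u v z.
rewrite !(mulmxDr, mulmxDl, mulmxN) -!mulmxA.
by apply/matrixP => a b; rewrite !(mxDE, mxNE); ring.
Qed.

(** Evaluate [curv_mx_phi] for phi_j on xi_j, in the kernel of phi_j, and take the
    component along xi_i. *)
Lemma xi_curv_eta i j k x u v : even3 i j k -> U x ->
  ev1 (eta k x) (xi j x *m curv_mx x u v) = 2 * alpha * beta * Psi i j k x u v.
Proof.
move=> e Ux; have C := cl_contact H Ux; have ej := even3_rot e.
have [ij jk ik] := even3_neq e.
have := congr1 (fun A => ev1 (eta i x) (xi j x *m A)) (curv_mx_phi u v ej Ux).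
move: (curv_mx x u v) => Rx; rewrite mulmxBr mulmxA (c3_xi_phi C) mul0mx sub0r mulmxA ev1N.
rewrite -[ev1 _ (_ *m phi j x)]ev1_mul (c3_phi_etar C e).
rewrite -scalemxAr mulmxBr -!scalemxAr (c3_xi_phir C ej) (c3_xi_phil C e) !ev1E.
rewrite !(c3_eta_xi C) eqxx (negPf ik) /= mulr1n mulr0n => /eqP.
by rewrite eqr_oppLR => /eqP ->; ring.
Qed.

Lemma xi_curv_eta_skew j k x u v : U x ->
  ev1 (eta j x) (xi k x *m curv_mx x u v) = - ev1 (eta k x) (xi j x *m curv_mx x u v).
Proof. by move=> Ux; rewrite -!metric_xi // curv_mx_skew34. Qed.

Lemma tr_phi i x : U x -> \tr (phi i x) = 0.
Proof.
move=> Ux; have C := cl_contact H Ux; have gu := posdef_unit (c3_g C).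
have : \tr (phi i x) = - \tr (phi i x).
  rewrite -{1}[phi i x](mulmxK gu) (c3_phi_g C) mulNmx linearN /= mxtrace_mulC mulKmx //.
  by rewrite mxtrace_tr.
by move: (\tr _) => t; lra.
Qed.

(** Multiply [curv_mx_phi] for phi_j by phi_k and take the trace: cyclicity of the
    trace produces twice the trace of R phi_i and a vertical correction, which is
    [xi_curv_eta]. *)
Lemma tr_curv_phi i j k x u v : even3 i j k -> U x ->
  \tr (curv_mx x u v *m phi i x) = - (alpha * beta * (m%:R + 1)) * Psi i j k x u v.
Proof.
move=> e Ux; have C := cl_contact H Ux; have ej := even3_rot e; have ek := even3_rot ej.
have [ij jk ik] := even3_neq e.
have tr1 (A : 'M[R]_m) e' u' : \tr (A *m (e' *m u')) = ev1 e' (u' *m A) by exact: tr_outer.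
have t1 e' u' : \tr (e' *m u' : 'M[R]_m) = ev1 e' u' by rewrite mxtrace_mulC trace_mx11.
have := congr1 (fun A => \tr (A *m phi k x)) (curv_mx_phi u v ej Ux).
have := xi_curv_eta u v e Ux; have := xi_curv_eta_skew j k u v Ux.
move: (curv_mx x u v) => Rx XS XE.
have -> : \tr ((phi j x *m Rx - Rx *m phi j x) *m phi k x)
    = 2 * \tr (Rx *m phi i x) + 2 * ev1 (eta k x) (xi j x *m Rx).
  rewrite mulmxBl linearB /= -mulmxA mxtrace_mulC -mulmxA (c3_phi_mul C ej).
  rewrite -mulmxA (c3_phi_mulN C ej) !mulmxDr mulmxN.
  rewrite 2!linearD linearN /= !tr1 XS; ring.
have -> : \tr ((2 * alpha * beta) *: (Psi i j k x u v *: phi k x - Psi k i j x u v *: phi i x)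
      *m phi k x) = 2 * alpha * beta * (Psi i j k x u v * (1 - m%:R)).
  rewrite -scalemxAl linearZ /= mulmxBl linearB /= -!scalemxAl !linearZ /=.
  have -> : \tr (phi k x *m phi k x) = 1 - m%:R.
    rewrite (c3_phi_sqr C) linearD linearN /= mxtrace1 t1 (c3_eta_xi C) eqxx mulr1n.
    by rewrite addrC.
  have -> : \tr (phi i x *m phi k x) = 0.
    rewrite (c3_phi_mul C ek) linearD /= tr_phi // t1 (c3_eta_xi C) (negPf ik) mulr0n.
    by rewrite addr0.
  by rewrite /GRing.scale /=; ring.
rewrite XE => E; apply: (@mulfI _ 2) => //.
by apply: (@addIr _ (2 * (2 * alpha * beta * Psi i j k x u v))); rewrite E; ring.
Qed.

(** * The curvature operator *)

(** A skew matrix A is half the sum of A a b e_a /\ e_b over all pairs; this and the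
    minus sign in the relation between the operator and R account for the
    factor. *)
Definition curv_op x (A : 'M[R]_m) : 'M[R]_m :=
  - 2^-1 *: \sum_a \sum_b A a b *: (invmx (g x) *m curv_mx x (delta_mx 0 a) (delta_mx 0 b)).

Fact curv_op_linear x : linear (curv_op x).
Proof.
move=> c A B; rewrite /curv_op scalerA mulrC -scalerA -scalerDr; congr (_ *: _).
rewrite scaler_sumr -big_split; apply: eq_bigr => a _ /=.
rewrite scaler_sumr -big_split; apply: eq_bigr => b _ /=.
by rewrite !mxE scalerDl scalerA.
Qed.

HB.instance Definition _ x := GRing.isLinear.Build R 'M[R]_m 'M[R]_m _ (curv_op x) (curv_op_linear x).

Definition curv4 x u v w z := ev2 (g x) (w *m curv_mx x u v) z.

Lemma curv_op_skew x A : U x -> Defs.skew (curv_op x A).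
Proof.
move=> Ux; have gp := c3_g (cl_contact H Ux); have gu := posdef_unit gp; have [gs _] := gp.
rewrite /Defs.skew /curv_op linearZ /= -scalerN; congr (_ *: _).
rewrite linear_sum -sumrN; apply: eq_bigr => a _.
rewrite linear_sum -sumrN; apply: eq_bigr => b _.
rewrite linearZ /= -scalerN; congr (_ *: _).
have := curv_mx_metric (delta_mx 0 a) (delta_mx 0 b) Ux; move: (curv_mx _ _ _) => Rx E.
rewrite trmx_mul trmx_inv gs -[Rx^T](mulKmx gu) -[g x *m Rx^T]opprK -E.
by rewrite mulmxN mulNmx -mulmxA mulmxK.
Qed.

Lemma curv_op_form x A w z : U x ->
  ev2 (g x *m curv_op x A *m g x) w z =
  - 2^-1 * \sum_a \sum_b A a b * curv4 x (delta_mx 0 a) (delta_mx 0 b) w z.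
Proof.
move=> Ux; have gu := posdef_unit (c3_g (cl_contact H Ux)).
have L (W : 'M[R]_m) : ev2 W w z = \tr (W *m (z^T *m w)).
  by rewrite mulmxA mxtrace_mulC mulmxA trace_mx11.
rewrite L /curv_op -scalemxAr -!scalemxAl linearZ /=; congr (_ * _).
rewrite mulmx_sumr !mulmx_suml linear_sum; apply: eq_bigr => a _ /=.
rewrite mulmx_sumr !mulmx_suml linear_sum; apply: eq_bigr => b _ /=.
rewrite -scalemxAr -!scalemxAl linearZ /= -L mulKVmx //; congr (_ * _).
by rewrite ev2_mull.
Qed.

Lemma curv_op_wedge x u v w z : U x ->
  inner2 (g x) (curv_op x (wedgev u v)) (wedgev w z) = - curv4 x u v w z.
Proof.
move=> Ux; have [gs _] := c3_g (cl_contact H Ux).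
rewrite inner2_wedger //; last exact: curv_op_skew.
rewrite curv_op_form //.
have S u' v' : \sum_a \sum_b (u' 0 a * v' 0 b) * curv4 x (delta_mx 0 a) (delta_mx 0 b) w z
    = curv4 x u' v' w z.
  have L W : ev2 (g x) (w *m W) z = \tr (W *m (g x *m z^T *m w)).
    by rewrite !mulmxA mxtrace_mulC !mulmxA trace_mx11.
  rewrite /curv4 (curv_mx_sum u' v' Ux) L mulmx_suml linear_sum; apply: eq_bigr => a _ /=.
  rewrite mulmx_suml linear_sum; apply: eq_bigr => b _ /=.
  by rewrite -scalemxAl linearZ /= L.
have -> : \sum_a \sum_b wedgev u v a b * curv4 x (delta_mx 0 a) (delta_mx 0 b) w z =
    curv4 x u v w z - curv4 x v u w z.
  rewrite -!S -sumrB; apply: eq_bigr => a _; rewrite -sumrB; apply: eq_bigr => b _.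
  by rewrite /wedgev mxDE mxNE !mxE !big_ord1 !mxE mulrBl.
have -> : curv4 x v u w z = - curv4 x u v w z by rewrite /curv4 curv_mx_skew mulmxN ev2Nl.
by field.
Qed.

Lemma curv_op_sym x A B : U x ->
  inner2 (g x) (curv_op x A) B = inner2 (g x) A (curv_op x B).
Proof.
move=> Ux; have [gs _] := c3_g (cl_contact H Ux).
rewrite [RHS]inner2C // !inner2_sum //; congr (_ * _).
have E D c d : (g x *m curv_op x D *m g x) c d =
   - 2^-1 * \sum_a \sum_b D a b * curv4 x (delta_mx 0 a) (delta_mx 0 b) (delta_mx 0 c) (delta_mx 0 d).
  by rewrite -curv_op_form // ev2_delta.
have S C D : \sum_c \sum_d C c d * (g x *m curv_op x D *m g x) c d =
   \sum_c \sum_d \sum_a \sum_b - 2^-1 * (C c d * D a b) *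
     curv4 x (delta_mx 0 a) (delta_mx 0 b) (delta_mx 0 c) (delta_mx 0 d).
  apply: eq_bigr => c _; apply: eq_bigr => d _; rewrite E !mulr_sumr.
  apply: eq_bigr => a _; rewrite !mulr_sumr; apply: eq_bigr => b _; ring.
rewrite !S exchange_big4; do 4 (apply: eq_bigr => ? _).
by rewrite [curv4 _ _ _ _ _]curv_mx_pair // [C in _ * C * _]mulrC.
Qed.

(** By pair symmetry the operator may be computed by contracting the 2-form W with
    the endomorphism R(w,z). *)
Lemma curv_op_sharp x W w z : U x ->
  ev2 (g x *m curv_op x (sharp (g x) W) *m g x) w z =
  2^-1 * \tr (curv_mx x w z *m W *m invmx (g x)).
Proof.
move=> Ux; have gu := posdef_unit (c3_g (cl_contact H Ux)).
rewrite curv_op_form //.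
have -> : \tr (curv_mx x w z *m W *m invmx (g x)) =
    - \sum_a \sum_b sharp (g x) W a b * (curv_mx x w z *m g x) a b.
  have NE : curv_mx x w z *m W *m invmx (g x) = curv_mx x w z *m g x *m sharp (g x) W.
    by rewrite /sharp !mulmxA mulmxK.
  have Ns : Defs.skew (curv_mx x w z *m g x).
    have [gs _] := c3_g (cl_contact H Ux).
    by rewrite /Defs.skew trmx_mul gs curv_mx_metric // opprK.
  rewrite NE; move: (curv_mx x w z *m g x) Ns (sharp _ _) => N Ns A.
  rewrite /mxtrace; under eq_bigr do rewrite mxE.
  rewrite exchange_big -sumrN; apply: eq_bigr => a _; rewrite -sumrN.
  by apply: eq_bigr => b _; rewrite (skewE a b Ns) mulNr mulrC.
rewrite mulrN -mulNr; congr (_ * _); apply: eq_bigr => a _; apply: eq_bigr => b _.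
by congr (_ * _); rewrite -ev2_delta ev2_mull; exact: curv_mx_pair.
Qed.

(** The eigenforms are the members a = -1 and a = n + 1 of this family. *)
Definition pencil i j k x (a : R) : 'M[R]_m :=
  Phi_at i x + a *: wedgef (eta j x) (eta k x).

Lemma pencil_skew i j k x a : U x -> Defs.skew (pencil i j k x a).
Proof.
move=> Ux; apply: ev2P => u v; rewrite ev2_tr ev2N /pencil !ev2D !ev2Z !ev2_wedgef.
by rewrite Phi_at_skew //; ring.
Qed.

Lemma pencil_xi i j k x a : even3 i j k -> U x ->
  ev2 (pencil i j k x a) (xi j x) (xi k x) = a - 1.
Proof.
move=> e Ux; have C := cl_contact H Ux; have [ij jk ik] := even3_neq e.
rewrite /pencil ev2D ev2Z ev2_wedgef (Phi_at_xir _ (even3_rot (even3_rot e)) Ux).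
by rewrite !(c3_eta_xi C) !eqxx (negPf jk) [k == j]eq_sym (negPf jk) /= mulr1n mulr0n; ring.
Qed.

Lemma pencil_inv i j k x a : U x ->
  pencil i j k x a *m invmx (g x) =
  - phi i x + a *: (eta j x *m xi k x - eta k x *m xi j x).
Proof.
move=> Ux; have C := cl_contact H Ux; have gu := posdef_unit (c3_g C); have [gs _] := c3_g C.
have eta_inv l : (eta l x)^T *m invmx (g x) = xi l x.
  by rewrite (c3_eta C) trmx_mul trmxK gs mulmxK.
rewrite /pencil mulmxDl -scalemxAl /wedgef mulmxBl -!mulmxA !eta_inv.
by congr (_ + _); rewrite mulmxA -[g x *m _]opprK -(c3_phi_g C) mulNmx mulmxK.
Qed.

(** The endomorphism dual to the form, [pencil_inv], is contracted with R by
    [tr_curv_phi] and [xi_curv_eta]. *)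
Lemma curv_op_eigen i j k x a : even3 i j k -> U x ->
  curv_op x (sharp (g x) (pencil i j k x a)) =
  (alpha * beta * ((m%:R + 1) / 2 - 2 * a)) *:
    sharp (g x) (Phi_at i x - wedgef (eta j x) (eta k x)).
Proof.
move=> e Ux; have C := cl_contact H Ux; have gu := posdef_unit (c3_g C).
have unsharp (A : 'M[R]_m) : A = sharp (g x) (g x *m A *m g x).
  by rewrite /sharp !mulmxA mulVmx // mul1mx mulmxK.
rewrite [LHS]unsharp (_ : g x *m _ *m g x = (alpha * beta * ((m%:R + 1) / 2 - 2 * a)) *:
    (Phi_at i x - wedgef (eta j x) (eta k x))); last first.
  apply: ev2P => w z; rewrite curv_op_sharp // -mulmxA pencil_inv //.
  have := tr_curv_phi w z e Ux; have := xi_curv_eta w z e Ux.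
  have := xi_curv_eta_skew j k w z Ux; move: (curv_mx x w z) => Rx XS XE TE.
  rewrite mulmxDr mulmxN -scalemxAr mulmxBr.
  rewrite linearD linearN /= linearZ /= linearB /= !tr_outer TE XS XE.
  rewrite ev2Z [ev2 (_ - _) _ _]ev2D ev2N ev2_wedgef /Psi /GRing.scale /=.
  by field.
by rewrite /sharp -scalemxAr -scalemxAl.
Qed.

(** * Inner products of the eigenforms *)

(** The inner product in terms of the endomorphisms dual to the 2-forms, whose
    products are known from the almost 3-contact relations. *)
Lemma inner2f_tr x (W W' : 'M[R]_m) : U x -> Defs.skew W ->
  inner2f (g x) W W' = - 2^-1 * \tr (W *m invmx (g x) *m (W' *m invmx (g x))).
Proof.
move=> Ux Ws; have gp := c3_g (cl_contact H Ux); have gu := posdef_unit gp; have [gs _] := gp.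
rewrite /inner2f /inner2 /sharp !trmx_mul trmx_inv gs Ws !mulmxA.
rewrite mulmxKV // mulmxKV // mulmxN !mulNmx linearN /= mulrN mulNr; congr (- (_ * _)).
by rewrite -!mulmxA mxtrace_mulC !mulmxA.
Qed.

Lemma inner2f_pencil i j k x a b : even3 i j k -> U x ->
  inner2f (g x) (pencil i j k x a) (pencil i j k x b) = (m%:R - 1) / 2 - a - b + a * b.
Proof.
move=> e Ux; have C := cl_contact H Ux; have [ij jk ik] := even3_neq e.
rewrite inner2f_tr //; last exact: pencil_skew.
rewrite !pencil_inv //; set P := _ - _.
have trP (A : 'M[R]_m) : \tr (A *m P) = ev1 (eta j x) (xi k x *m A) - ev1 (eta k x) (xi j x *m A).
  by rewrite mulmxBr linearB /= !tr_outer.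
have xiP l : xi l x *m P = (l == j)%:R *: xi k x - (l == k)%:R *: xi j x.
  by rewrite mulmxBr !mul_row_outer !(c3_eta_xi C) ![_ == l]eq_sym.
rewrite mxtrace_affine_mul [\tr (P *m phi i x)]mxtrace_mulC !trP !xiP.
rewrite (c3_phi_sqr C) mxtraceD linearN /= mxtrace1 [\tr (eta i x *m _)]mxtrace_mulC trace_mx11 -/(ev1 _ _).
rewrite (c3_xi_phil C e) (c3_xi_phir C (even3_rot (even3_rot e))) !ev1E !(c3_eta_xi C).
rewrite !eqxx ![k == j]eq_sym (negPf jk) /= mulr1n mulr0n /GRing.scale /=.
by field.
Qed.

Lemma inner2f_pencil_rot i j k x a b : even3 i j k -> U x ->
  inner2f (g x) (pencil i j k x a) (pencil j k i x b) = 0.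
Proof.
move=> e Ux; have C := cl_contact H Ux; have [ij jk ik] := even3_neq e.
rewrite inner2f_tr //; last exact: pencil_skew.
rewrite !pencil_inv //; set P := _ - _; set Q := _ - _.
have trP (A : 'M[R]_m) : \tr (A *m P) = ev1 (eta j x) (xi k x *m A) - ev1 (eta k x) (xi j x *m A).
  by rewrite mulmxBr linearB /= !tr_outer.
have trQ (A : 'M[R]_m) : \tr (A *m Q) = ev1 (eta k x) (xi i x *m A) - ev1 (eta i x) (xi k x *m A).
  by rewrite mulmxBr linearB /= !tr_outer.
have xiP l : xi l x *m P = (l == j)%:R *: xi k x - (l == k)%:R *: xi j x.
  by rewrite mulmxBr !mul_row_outer !(c3_eta_xi C) ![_ == l]eq_sym.
rewrite mxtrace_affine_mul [\tr (P *m phi j x)]mxtrace_mulC !trP !trQ !xiP.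
rewrite (c3_phi_mulN C e) mxtraceD linearN /= tr_phi // [\tr (eta i x *m _)]mxtrace_mulC trace_mx11 -/(ev1 _ _).
rewrite !(c3_xi_phi C) (c3_xi_phil C (even3_rot e)) (c3_xi_phir C (even3_rot (even3_rot e))).
have Z (f : 'cV[R]_m) : ev1 f 0 = 0 by rewrite /ev1 mul0mx mxE.
rewrite !ev1E !Z !(c3_eta_xi C).
rewrite !eqxx ?[k == j]eq_sym ?[j == i]eq_sym ?[k == i]eq_sym ?(negPf jk) ?(negPf ij) ?(negPf ik).
by rewrite /= ?mulr1n ?mulr0n /GRing.scale /=; ring.
Qed.

(** Projecting removes the vertical part - eta_j /\ eta_k of Phi_i; there is no mixed
    part. *)
Lemma Phi_horizontal i j k x : even3 i j k -> U x ->
  (1%:M - \sum_l eta l x *m xi l x) *m Phi_at i x *m (1%:M - \sum_l eta l x *m xi l x)^T =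
  pencil i j k x 1.
Proof.
move=> e Ux; have ej := even3_rot e; have ek := even3_rot ej; have C := cl_contact H Ux.
have [ij jk ik] := even3_neq e.
apply: ev2P => u v; rewrite ev2_mul /pencil scale1r ev2D ev2_wedgef.
rewrite !mulmxBr !mulmx1 !mulmx_sumr !(sum_even3 _ e) !mul_row_outer.
rewrite !(opprD, ev2E) !Phi_at_xi //.
rewrite ![ev2 _ (xi _ x) v]Phi_at_skew // !Phi_at_xi //.
rewrite !(Phi_at_xil _ e) // !(Phi_at_xir _ ek) //.
rewrite !(c3_eta_xi C) !eqxx ?[k == j]eq_sym ?[j == i]eq_sym ?[k == i]eq_sym.
by rewrite ?(negPf jk) ?(negPf ij) ?(negPf ik) /= ?mulr1n ?mulr0n; ring.
Qed.

End CanonicalLocal.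

(** * The theorem *)

(** Evaluated on constant coordinate fields, whose brackets vanish, the hypotheses
    become identities between matrices and their coordinate derivatives. *)
Lemma canonical_localP (R : realType) (m : nat) (M : manifold R m)
    (phi : 'I_3 -> field M 'M[R]_m) (xi : 'I_3 -> field M 'rV[R]_m)
    (eta : 'I_3 -> field M 'cV[R]_m) (g : field M 'M[R]_m)
    (G : field M ('I_m -> 'M[R]_m)) (alpha delta : R) (c : charts M) :
  three_alpha_delta_Sasaki alpha delta phi xi eta g ->
  canonical_connection alpha delta phi eta g G ->
  canonical_local (img c) (fun i => phi i c) (fun i => xi i c) (fun i => eta i c) (g c)
    (G c) alpha delta (2 * (delta - 2 * alpha)).
Proof.
move=> [A a0 deta] [[sG _] met skewT dphi].
have acm i := a3c_acm A i.
have sphi i : smooth (img c) (phi i c) by have [/(_ c)] := acm_phi (acm i).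
have sxi i : smooth (img c) (xi i c) by have [/(_ c)] := acm_xi (acm i).
have seta i : smooth (img c) (eta i c) by have [/(_ c)] := acm_eta (acm i).
have sg : smooth (img c) (g c) by have [/(_ c)] := acm_g (acm 0).
have cst0 (u v x : 'rV[R]_m) : along (fun=> u) (fun=> v) x = 0.
  exact: has_dir_along (has_dir_cst u x v).
have nabla_cst x u v : nabla (G c) (fun=> u) (fun=> v) x = v *m conn_mx (G c) x u.
  by rewrite /nabla cst0 add0r christoffelE.
have tors_cst x u v : torsion (G c) (fun=> u) (fun=> v) x = tors (G c) x u v.
  by rewrite /torsion /bracket !cst0 subrr subr0 !nabla_cst.
split=> //.
- exact: cimg_open.
- by move=> x cx; exact: contact3_atP.
- move=> i j k x u e cx; have D := smooth_has_dir u (sphi i) cx.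
  apply: has_dir_eq (D) _; apply: eq_mulrow => v.
  have := dphi i j k c _ _ x e (smooth_cst _ u) (smooth_cst _ v) cx.
  rewrite /nabla_end nabla_cst /app /nabla christoffelE.
  rewrite (has_dir_along (has_dir_mulmx (has_dir_cst u x v) D)) mul0mx add0r.
  move: (along _ _ _) => d E; rewrite mulmxDr mulmxBr !mulmxA /rotation.
  rewrite -scalemxAr mulmxBr -!scalemxAr -E.
  by rewrite [RHS]addrC addrA subrK addrK.
- move=> x u cx; have D := smooth_has_dir u sg cx.
  apply: has_dir_eq (D) _; apply: ev2P => v w.
  have := met c _ _ _ x (smooth_cst _ u) (smooth_cst _ v) (smooth_cst _ w) cx.
  have D2 := has_dir_ev2 D (has_dir_cst u x v) (has_dir_cst u x w).
  rewrite (has_dir_along D2) !nabla_cst ev2D ev2_mull ev2_mulr => <-.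
  have -> : ev2 (g c x) 0 w = 0 by rewrite /ev2 !mul0mx mxE.
  have -> : ev2 (g c x) v 0 = 0 by rewrite /ev2 trmx0 mulmx0 mxE.
  by rewrite !addr0.
- move=> x u v w cx.
  have := skewT c _ _ _ x (smooth_cst _ u) (smooth_cst _ v) (smooth_cst _ w) cx.
  by rewrite !tors_cst.
- move=> i j k x u v e cx.
  have := deta i j k c _ _ x e (smooth_cst _ u) (smooth_cst _ v) cx.
  have D a b : along (W := R) (fun=> a) (fun y => ev1 (eta i c y) b) x =
      ev1 (along (fun=> a) (eta i c) x) b.
    have De := smooth_has_dir a (seta i) cx.
    rewrite (has_dir_along (has_dir_ev1 De (has_dir_cst a x b))).
    by rewrite /ev1 mul0mx [X in _ + X]mxE addr0.
  rewrite /d1 !D /bracket !cst0 subrr ev2_wedgef.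
  have -> : ev1 (eta i c x) 0 = 0 by rewrite /ev1 mul0mx mxE.
  by rewrite subr0.
Qed.

Theorem theorem2p2 (R : realType) (n : nat) (hn : (1 <= n)%N)
    (M : manifold R (4 * n + 3)%N)
    (phi : 'I_3 -> field M 'M[R]_(4 * n + 3)%N)
    (xi : 'I_3 -> field M 'rV[R]_(4 * n + 3)%N)
    (eta : 'I_3 -> field M 'cV[R]_(4 * n + 3)%N)
    (g : field M 'M[R]_(4 * n + 3)%N)
    (nabla : field M ('I_(4 * n + 3)%N -> 'M[R]_(4 * n + 3)%N))
    (alpha delta : R)
    (hS : three_alpha_delta_Sasaki alpha delta phi xi eta g)
    (hnabla : canonical_connection alpha delta phi eta g nabla)
    (p : M) (c : charts M) (hp : cdom (chart_of c) p) :
  let beta : R := 2 * (delta - 2 * alpha) in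
  let x := cmap (chart_of c) p in
  let Ph i := Phi (phi i) g c x in
  let PhH i := horizontal_part xi eta (Phi (phi i) g) c x in
  let xi2 j k := wedgef (eta j c x) (eta k c x) in
  let W1 i j k := Ph i - xi2 j k in
  let W2 i j k := Ph i + (n%:R + 1) *: xi2 j k in
  exists L : {linear 'M[R]_(4 * n + 3)%N -> 'M[R]_(4 * n + 3)%N},
    [/\ curvature_operator g nabla c x L,
        forall i j k, even3 i j k ->
          [/\ W1 i j k = PhH i - 2 *: xi2 j k,
              eigenform (g c x) L (2 * alpha * beta * (n%:R + 2)) (W1 i j k),
              W2 i j k = PhH i + n%:R *: xi2 j k
            & eigenform (g c x) L 0 (W2 i j k)]
      & forall i j k i' j' k', even3 i j k -> even3 i' j' k' ->
          [/\ inner2f (g c x) (W1 i j k) (W2 i' j' k') = 0,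
              i != i' -> inner2f (g c x) (W1 i j k) (W1 i' j' k') = 0
            & i != i' -> inner2f (g c x) (W2 i j k) (W2 i' j' k') = 0]].
Proof.
move=> beta x Ph PhH xi2 W1 W2.
have H := canonical_localP c hS hnabla.
have Ux : img c x by exact: cmap_img.
have C := cl_contact H Ux; have [gs gp] := c3_g C.
have W1E i j k : W1 i j k = pencil (fun i => phi i c) (fun i => eta i c) (g c) i j k x (-1).
  by rewrite /pencil scaleN1r.
have W2E i j k : W2 i j k = pencil (fun i => phi i c) (fun i => eta i c) (g c) i j k x (n%:R + 1).
  by [].
have PhHE i j k : even3 i j k ->
    PhH i = pencil (fun i => phi i c) (fun i => eta i c) (g c) i j k x 1.
  by move=> e; rewrite -(Phi_horizontal H e Ux).
have mE : (4 * n + 3)%N%:R = 4 * n%:R + 3 :> R by rewrite natrD natrM.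
pose pn a i j k := pencil (fun i => phi i c) (fun i => eta i c) (g c) i j k x a.
have nonzero a i j k : even3 i j k -> a != 1 -> pn a i j k != 0.
  move=> e; apply: contraNneq => W0; rewrite -subr_eq0 -(pencil_xi H a e Ux) -/(pn a i j k) W0.
  by rewrite /ev2 mulmx0 mul0mx mxE.
have eigen a i j k : even3 i j k ->
    curv_op (g c) (nabla c) x (sharp (g c x) (pn a i j k)) =
    (2 * alpha * beta * (n%:R + 1 - a)) *: sharp (g c x) (W1 i j k).
  move=> e; rewrite /pn (curv_op_eigen H _ e Ux) mE; congr (_ *: _).
  by rewrite -/beta; field.
exists (curv_op (g c) (nabla c) x); split.
- split=> [A _|A B _ _|X Y Z V sX sY sZ sV].
  + exact: (curv_op_skew H).
  + exact: (curv_op_sym H).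
  + by rewrite (curv_op_wedge H) // (curvatureE H).
- move=> i j k e; split.
  + by rewrite W1E (PhHE _ _ _ e) /pencil -addrA -scaleNr -scalerDl; congr (_ + _ *: _); ring.
  + have m1 : -1 != 1 :> R by rewrite lt_eqF // (@lt_trans _ _ 0) ?ltr01 // oppr_lt0 ltr01.
    split; [by rewrite W1E; exact: (pencil_skew H)|by rewrite W1E; exact: nonzero|].
    by have := eigen (-1) _ _ _ e; rewrite /pn -W1E opprK -addrA.
  + by rewrite W2E (PhHE _ _ _ e) /pencil -addrA -scalerDl; congr (_ + _ *: _); ring.
  + have n1 : n%:R + 1 != 1 :> R by rewrite -subr_eq0 addrK pnatr_eq0 -lt0n.
    split; [by rewrite W2E; exact: (pencil_skew H)|by rewrite W2E; exact: nonzero|].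
    by have := eigen (n%:R + 1) _ _ _ e; rewrite /pn -W2E subrr mulr0 !scale0r.
have orth a b i j k i' j' k' : even3 i j k -> even3 i' j' k' -> i != i' ->
    inner2f (g c x) (pn a i j k) (pn b i' j' k') = 0.
  move=> e e'; have ej := even3_rot e; have ek := even3_rot ej.
  move: e'; rewrite even3E => -[-> ->]; have [->|->|->] := even3_cases i' e; rewrite ?eqxx // => _.
    move: (ej); rewrite even3E => -[<- <-]; exact: (inner2f_pencil_rot H).
  move: (ek); rewrite even3E => -[<- <-]; rewrite /inner2f inner2C //.
  exact: (inner2f_pencil_rot H).
move=> i j k i' j' k' e e'; split.
- rewrite W1E W2E; have [ii'|] := eqVneq i i'; last exact: orth.
  move: e'; rewrite -ii' !even3E in e * => -[-> ->]; move: e => [-> ->].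
  have e := even3_ordS i.
  by rewrite (inner2f_pencil H) // mE; field.
- by rewrite !W1E; exact: orth.
- by rewrite !W2E; exact: orth.
Qed.
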